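(* Let $(A,\mathfrak{m})$ be a Cohen-Macaulay local ring of dimension $d \geq 2$ with infinite residue field, and let $I$ be an $\mathfrak{m}$-primary ideal of $A$. If the associated graded ring $G(I) = \bigoplus_{n\geq 0} I^n/I^{n+1}$ is generalized Cohen-Macaulay, then $(I^n)_1 = \widetilde{I^n}$ for all $n \geq 1$.
   Context: Rings are commutative Noetherian. $\lambda$ denotes length. For an $\mathfrak{m}$-primary ideal $K$ of a Noetherian local ring $(A,\mathfrak{m})$ of dimension $d$, the Hilbert coefficients $e_0(K),\dots,e_d(K)$ are the integers such that $\lambda(A/K^{n+1}) = \sum_{i=0}^{d}(-1)^i e_i(K)\binom{n+d-i}{d-i}$ for all $n\gg 0$. Coefficient ideals: for an $\mathfrak{m}$-primary ideal $K$ and $0\le i\le d$, let $E_i(K)$ be the set of ($\mathfrak{m}$-primary) ideals $J \supseteq K$ with $e_j(J)=e_j(K)$ for $0\le j\le i$. When $A$ is quasi-unmixed with infinite residue field (in particular when $A$ is Cohen-Macaulay with infinite residue field), $E_i(K)$ has a unique maximal element (Rees for $i=0$, Shah in general), denoted $K_i$ and called the $i$-th coefficient ideal of $K$. Thus $(I^n)_1$ is the first coefficient ideal of $I^n$. Ratliff-Rush closure: $\widetilde{K} = \bigcup_{m\ge 1}(K^{m+1}:K^m)$. $G(I)$ (which has dimension $d$) is generalized Cohen-Macaulay if the local cohomology modules $H^i_{G(I)_+}(G(I))$ have finite length for $0\le i\le d-1$. *)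

(* Defs.v *)
From HB Require Import structures.
From mathcomp Require Import all_boot all_order all_algebra.
From mathcomp Require Import boolp classical_sets functions cardinality.

Set Implicit Arguments.
Unset Strict Implicit.
Unset Printing Implicit Defensive.

Import GRing.Theory.
Local Open Scope classical_set_scope.
Local Open Scope ring_scope.
Local Open Scope quotient_scope.

Definition is_submodule (R : pzRingType) (M : lmodType R) (N : set M) : Prop :=
  [/\ N 0, forall x y, N x -> N y -> N (x + y) & forall r x, N x -> N (r *: x)].

(* The length of N2/N1, for submodules N1 `<=` N2 of M, read off from the
   chains of submodules of M lying between N1 and N2. *)
Definition has_chain (R : pzRingType) (M : lmodType R) (N1 N2 : set M)
    (n : nat) : Prop :=
  exists c : nat -> set M,
    (forall i, (i <= n)%N ->
       [/\ is_submodule (c i), N1 `<=` c i & c i `<=` N2]) /\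
    (forall i, (i < n)%N -> c i `<` c i.+1).

Definition has_length (R : pzRingType) (M : lmodType R) (N1 N2 : set M)
    (n : nat) : Prop :=
  has_chain N1 N2 n /\ forall k, has_chain N1 N2 k -> (k <= n)%N.

Definition finite_length (R : pzRingType) (M : lmodType R) (N1 N2 : set M)
  : Prop := exists n, has_length N1 N2 n.

Section Ideals.
Variable R : comPzRingType.
Implicit Types I J K P : set R.

Definition is_ideal I : Prop := @is_submodule R R^o I.

Definition ideal_gen (X : set R) : set R := smallest is_ideal X.

Definition ideal_mul I J : set R :=
  ideal_gen [set z | exists x y, [/\ I x, J y & z = x * y]].

Fixpoint ideal_exp I (n : nat) : set R :=
  if n is k.+1 then ideal_mul I (ideal_exp I k) else setT.

Arguments ideal_exp : simpl never.

(* (I : J) *)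
Definition ideal_colon I J : set R := [set x | forall y, J y -> I (x * y)].

Definition radical I : set R := [set x | exists n, I (x ^+ n)].

Definition prime_ideal P : Prop :=
  [/\ is_ideal P, ~ P 1 & forall x y, P (x * y) -> P x \/ P y].

Definition primary_ideal K : Prop :=
  [/\ is_ideal K, ~ K 1 & forall x y, K (x * y) -> K x \/ radical K y].

Definition maximal_ideal P : Prop :=
  [/\ is_ideal P, ~ P 1 &
      forall J, is_ideal J -> ~ J 1 -> P `<=` J -> J = P].

Definition noetherian : Prop :=
  forall I, is_ideal I -> exists s : seq R, I = ideal_gen [set` s].

Definition local_ring (m : set R) : Prop :=
  maximal_ideal m /\ forall P, maximal_ideal P -> P = m.

Definition has_prime_chain (n : nat) : Prop :=
  exists c : nat -> set R,
    (forall i, (i <= n)%N -> prime_ideal (c i)) /\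
    (forall i, (i < n)%N -> c i `<` c i.+1).

Definition krull_dim (d : nat) : Prop :=
  has_prime_chain d /\ forall k, has_prime_chain k -> (k <= d)%N.

Definition regular_sequence (s : seq R) : Prop :=
  ~ ideal_gen [set` s] 1 /\
  forall i, (i < size s)%N -> forall x,
    ideal_gen [set` take i s] (s`_i * x) -> ideal_gen [set` take i s] x.

(* depth of the local ring (R, m) *)
Definition has_depth (m : set R) (d : nat) : Prop :=
  (exists s, [/\ regular_sequence s, [set` s] `<=` m & size s = d]) /\
  (forall s, regular_sequence s -> [set` s] `<=` m -> (size s <= d)%N).

Definition CM_local_ring (m : set R) (d : nat) : Prop :=
  [/\ noetherian, local_ring m, krull_dim d & has_depth m d].

(* R/m, as the set of cosets of m *)
Definition cosets (m : set R) : set (set R) :=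
  range (fun a : R => [set b | m (b - a)]).

Definition primary_to (m K : set R) : Prop :=
  primary_ideal K /\ radical K = m.

Definition ratliff_rush K : set R :=
  \bigcup_(k in [set k : nat | (1 <= k)%N])
     ideal_colon (ideal_exp K k.+1) (ideal_exp K k).

(* Only the values e 0, ..., e d are meaningful. *)
Definition hilbert_coeffs (d : nat) K (e : nat -> int) : Prop :=
  exists N : nat, forall n : nat, (N <= n)%N ->
    exists l : nat,
      @has_length R R^o (ideal_exp K n.+1) setT l /\
      l%:Z = \sum_(i < d.+1) (-1) ^+ i * e i * ('C(n + d - i, d - i))%:Z.

Definition coeff_family (m : set R) (d i : nat) K : set (set R) :=
  [set J | [/\ primary_to m J, K `<=` J &
    exists e e', [/\ hilbert_coeffs d K e, hilbert_coeffs d J e' &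
                     forall j, (j <= i)%N -> e' j = e j]]].

Definition maximal_in (E : set (set R)) (L : set R) : Prop :=
  E L /\ forall J, E J -> L `<=` J -> J = L.

(* The unique maximal element of coeff_family m d i K; the default value set0,
   taken when there is no such element, is not an ideal. *)
Definition coeff_ideal (m : set R) (d i : nat) K : set R :=
  xget set0 [set L | maximal_in (coeff_family m d i K) L /\
                     forall L', maximal_in (coeff_family m d i K) L' -> L' = L].

Lemma is_ideal_gen (X : set R) : is_ideal (ideal_gen X).
Proof.
split=> [J [[]]//|x y hx hy J hJ|r x hx J hJ].
  by have [[_ hD _] _] := hJ; apply: hD; [apply: hx|apply: hy].
by have [[_ _ hM] _] := hJ; apply: hM; apply: hx.
Qed.

Lemma is_ideal_exp I n : is_ideal (ideal_exp I n).
Proof. by case: n => [|n]; [split|apply: is_ideal_gen]. Qed.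

Lemma ideal_exp0 I n : ideal_exp I n 0.
Proof. by have [] := is_ideal_exp I n. Qed.

Lemma ideal_expD I n x y :
  ideal_exp I n x -> ideal_exp I n y -> ideal_exp I n (x + y).
Proof. by have [_ h _] := is_ideal_exp I n; apply: h. Qed.

Lemma ideal_expZ I n r x : ideal_exp I n x -> ideal_exp I n (r * x).
Proof. by have [_ _ h] := is_ideal_exp I n; apply: h. Qed.

Lemma ideal_expN I n x : ideal_exp I n x -> ideal_exp I n (- x).
Proof. by rewrite -mulN1r; apply: ideal_expZ. Qed.

Lemma ideal_exp_sum I n (T : Type) (s : seq T) (Q : pred T) (F : T -> R) :
  (forall t, Q t -> ideal_exp I n (F t)) ->
  ideal_exp I n (\sum_(t <- s | Q t) F t).
Proof.
move=> h; apply: (big_ind (ideal_exp I n)) => //; first exact: ideal_exp0.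
exact: ideal_expD.
Qed.

Lemma ideal_exp_mul I p q x y :
  ideal_exp I p x -> ideal_exp I q y -> ideal_exp I (p + q) (x * y).
Proof.
elim: p x => [|p IH] x hx hy; first exact: ideal_expZ.
move: (hx); apply: (smallest_sub (X := [set x | ideal_exp I (p.+1 + q) (x * y)])).
  split=> [|a b /= ha hb|r a /= ha].
  - by rewrite /= mul0r; exact: (ideal_exp0 I (p.+1 + q)).
  - by rewrite mulrDl; apply: ideal_expD.
  - by rewrite -[r *: a]/(r * a) -mulrA; apply: ideal_expZ.
move=> _ [a [b [ha hb ->]]] /=; rewrite -mulrA => K [_]; apply.
by exists a, (b * y); split=> //; apply: IH.
Qed.

End Ideals.

(* The Rees algebra A[It], as the subring of A[t] of the polynomials whose i-th
   coefficient lies in I^i. *)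
Definition rees_pred (A : comNzRingType) (I : set A) : {pred {poly A}} :=
  fun p => `[< forall i, ideal_exp I i p`_i >].

Lemma reesP (A : comNzRingType) (I : set A) (p : {poly A}) :
  reflect (forall i, ideal_exp I i p`_i) (p \in rees_pred I).
Proof. exact: asboolP. Qed.

Lemma rees_subring_closed (A : comNzRingType) (I : set A) :
  subring_closed (rees_pred I).
Proof.
split=> [|p q /reesP hp /reesP hq|p q /reesP hp /reesP hq]; apply/reesP => i.
- by rewrite coef1; case: i => [|i] //; apply: (ideal_exp0 I i.+1).
- by rewrite coefB; apply: ideal_expD => //; apply: ideal_expN.
- rewrite coefM; apply: ideal_exp_sum => j _.
  have {1}-> : i = (j + (i - j))%N by rewrite subnKC // -ltnS.
  exact: ideal_exp_mul.
Qed.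

HB.instance Definition _ (A : comNzRingType) (I : set A) :=
  GRing.isSubringClosed.Build {poly A} (rees_pred I) (rees_subring_closed I).

Record rees (A : comNzRingType) (I : set A) :=
  Rees { rees_poly : {poly A}; _ : rees_poly \in rees_pred I }.

HB.instance Definition _ (A : comNzRingType) (I : set A) :=
  [isSub of rees I for @rees_poly A I].
HB.instance Definition _ (A : comNzRingType) (I : set A) :=
  [Choice of rees I by <:].
HB.instance Definition _ (A : comNzRingType) (I : set A) :=
  [SubChoice_isSubComNzRing of rees I by <:].

(* The ideal I A[It] = (+)_n I^(n+1) t^n of A[It]. *)
Definition gr_ideal (A : comNzRingType) (I : set A) : {pred rees I} :=
  fun p => `[< forall i, ideal_exp I i.+1 (val p)`_i >].
Arguments gr_ideal {A} I _.

Lemma gr_idealP (A : comNzRingType) (I : set A) (p : rees I) :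
  reflect (forall i, ideal_exp I i.+1 (val p)`_i) (p \in gr_ideal I).
Proof. exact: asboolP. Qed.

Lemma gr_ideal_zmod_closed (A : comNzRingType) (I : set A) :
  zmod_closed (gr_ideal I).
Proof.
split=> [|p q /gr_idealP hp /gr_idealP hq]; apply/gr_idealP => i.
- by rewrite raddf0 coef0; apply: (ideal_exp0 I i.+1).
- by rewrite raddfB coefB; apply: ideal_expD => //; apply: ideal_expN.
Qed.

HB.instance Definition _ (A : comNzRingType) (I : set A) :=
  GRing.isZmodClosed.Build (rees I) (gr_ideal I) (gr_ideal_zmod_closed I).

Lemma gr_idealM (A : comNzRingType) (I : set A) (p q : rees I) :
  p \in gr_ideal I -> q * p \in gr_ideal I.
Proof.
move=> /gr_idealP hp; apply/gr_idealP => i.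
have /reesP hq := valP q.
rewrite rmorphM coefM; apply: ideal_exp_sum => j _.
have {1}-> : i.+1 = (j + (i - j).+1)%N by rewrite addnS subnKC // -ltnS.
exact: ideal_exp_mul.
Qed.

(* The associated graded ring G(I) = A[It] / I A[It].  It is built by hand
   rather than with the ring structure on {ideal_quot _}, which asks for a proper ideal and hence for
   I != A. *)
Definition gr (A : comNzRingType) (I : set A) : Type := Quotient.quot (gr_ideal I).

HB.instance Definition _ (A : comNzRingType) (I : set A) :=
  GRing.Zmodule.on (gr I).
HB.instance Definition _ (A : comNzRingType) (I : set A) :=
  EqQuotient.on (gr I).

Section GrRing.
Variables (A : comNzRingType) (I : set A).

Definition gr_one : gr I := lift_cst (gr I) 1.
Definition gr_mul := lift_op2 (gr I) *%R.

Canonical pi_gr_one_morph := PiConst gr_one.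

Lemma pi_gr_mul : {morph \pi : x y / x * y >-> gr_mul x y}.
Proof.
move=> x y; unlock gr_mul; apply/eqP; rewrite piE Quotient.equivE.
rewrite -[_ * _](addrNK (x * repr (\pi_(gr I) y))) -mulrBr -addrA -mulrBl.
rewrite rpredD //; first by rewrite gr_idealM // Quotient.idealrBE reprK.
by rewrite mulrC gr_idealM // Quotient.idealrBE reprK.
Qed.
Canonical pi_gr_mul_morph := PiMorph2 pi_gr_mul.

Lemma gr_mulA : associative gr_mul.
Proof. by move=> x y z; rewrite -[x]reprK -[y]reprK -[z]reprK !piE mulrA. Qed.

Lemma gr_mulC : commutative gr_mul.
Proof. by move=> x y; rewrite -[x]reprK -[y]reprK !piE mulrC. Qed.

Lemma gr_mul1 : left_id gr_one gr_mul.
Proof. by move=> x; rewrite -[x]reprK !piE mul1r. Qed.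

Lemma gr_mulDl : left_distributive gr_mul +%R.
Proof.
move=> x y z; rewrite -[x]reprK -[y]reprK -[z]reprK.
by rewrite -!(rmorphD, raddfD) /= -!pi_gr_mul mulrDl raddfD.
Qed.

HB.instance Definition _ := GRing.Zmodule_isComPzRing.Build (gr I)
  gr_mulA gr_mulC gr_mul1 gr_mulDl.

(* The irrelevant ideal G(I)_+ *)
Definition gr_plus : set (gr I) :=
  [set \pi_(gr I) p | p in [set p : rees I | (val p)`_0 = 0]].

End GrRing.
Arguments gr_plus {A} I _.

Definition injective_module (R : pzRingType) (E : lmodType R) : Prop :=
  forall (M N : lmodType R) (f : {linear M -> N}) (g : {linear M -> E}),
    injective f -> exists h : {linear N -> E}, forall x, h (f x) = g x.

(* 0 -> M -> E 0 -> E 1 -> ... *)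
Record injective_resolution (R : pzRingType) (M : lmodType R) := {
  ires_obj : nat -> lmodType R;
  ires_aug : {linear M -> ires_obj 0%N};
  ires_dif : forall n, {linear ires_obj n -> ires_obj n.+1};
  ires_injective : forall n, injective_module (ires_obj n);
  ires_aug_inj : injective ires_aug;
  ires_exact0 : forall x, ires_dif 0%N x = 0 <-> exists y, ires_aug y = x;
  ires_exactS : forall n x,
    ires_dif n.+1 x = 0 <-> exists y, ires_dif n y = x
}.

(* The section functor Gamma_a *)
Definition torsion (R : comPzRingType) (a : set R) (M : lmodType R) : set M :=
  [set x | exists k, forall r, ideal_exp a k r -> r *: x = 0].

Arguments torsion {R} a M _.

(* H^i_a(M) is the i-th cohomology of Gamma_a applied to an injective
   resolution E of M, i.e. lc_cocycles a E i / lc_coboundaries a E i. *)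
Definition lc_cocycles (R : comPzRingType) (a : set R) (M : lmodType R)
    (E : injective_resolution M) (i : nat) : set (ires_obj E i) :=
  [set x | torsion a _ x /\ ires_dif E i x = 0].

Arguments lc_cocycles {R} a {M} E i _.

Definition lc_coboundaries (R : comPzRingType) (a : set R) (M : lmodType R)
    (E : injective_resolution M) (i : nat) : set (ires_obj E i) :=
  match i return set (ires_obj E i) with
  | 0%N => [set 0]
  | j.+1 => ires_dif E j @` torsion a (ires_obj E j)
  end.

Arguments lc_coboundaries {R} a {M} E i _.

(* G(I) is generalized Cohen-Macaulay, d being its dimension.  The cohomology
   modules do not depend on the injective resolution. *)
Definition gr_generalized_CM (A : comNzRingType) (I : set A) (d : nat)
  : Prop :=
  exists E : injective_resolution (gr I)^o,
    forall i, (i < d)%N ->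
      finite_length (lc_coboundaries (gr_plus I) E i)
                    (lc_cocycles (gr_plus I) E i).

(* Main.v *)
(** Write G for G(I).  If J contains K = I^p and has the same e_0 and e_1, the length
    of J^(k+1)/K^(k+1) is O(k^(d-2)).  For x in J one shows by induction on i <= p
    that x I^k lies in I^(k+i) for large k; the obstruction at each step is a finite
    set of homogeneous y in G, and the length bound says that G y has dimension at
    most d - 1.  So there are w_1, ..., w_(d-1) of degree one and z_1, ..., z_q
    annihilating y such that (z, w) contains a power of G_+.  For every M, the element
    y gives a class in degree d - 1 of the Koszul complex on z, w_1^M, ..., w_(d-1)^M,
    whose cohomology is G_+-torsion.  As G_+ ^ c annihilates H^i_(G_+)(G) for i < d,
    some power of G_+, independent of M, annihilates this class, hence maps y into
    (w_1^M, ..., w_(d-1)^M).  Taking M larger than all degrees involved, that power of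
    G_+ annihilates y.  Thus x I^k lies in I^(k+p) for large k, that is, x is in the
    Ratliff-Rush closure of K.  Conversely the powers of the closure eventually agree
    with those of K, so it has all the Hilbert coefficients of K. *)
Require Import Defs.
From HB Require Import structures.
From mathcomp Require Import all_boot all_order all_algebra.
From mathcomp Require Import boolp classical_sets functions cardinality.
From mathcomp Require Import ring zify.

Set Implicit Arguments.
Unset Strict Implicit.
Unset Printing Implicit Defensive.

Import GRing.Theory.
Local Open Scope classical_set_scope.
Local Open Scope ring_scope.
Local Open Scope quotient_scope.

Arguments ideal_exp : simpl never.

(** * Ideals and chain conditions *)

(** The numerical point is that [d - 1 < d]. Equality of e_0 and e_1 cancels the two top terms of a
    Hilbert polynomial of degree d, so [G y] loses one dimension; its d - 1 parameters put the
    Koszul class in degree d - 1, the last one in which finite length is assumed. The obstacle is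
    that the annihilating power must be known before [M] is chosen. Hence the Koszul complex is
    formed on an injective resolution, as an iterated cone. Its terms are injective and its
    cohomology is torsion, so every class has a torsion representative; on the torsion subcomplex
    each cone at most squares the annihilator, whatever its element, so the exponent depends only on
    the number of elements. The Koszul complex of [G] injects on cohomology, which brings the
    vanishing back to [G]. The infinite residue field yields parameters of degree one: points of a
    moment curve are in general position by Vandermonde. Homogeneous ideals are encoded as families
    of ideals of [A], so that Hilbert functions are lengths over [A]. *)

Lemma submodB (R : pzRingType) (M : lmodType R) (N : set M) x y :
  is_submodule N -> N x -> N y -> N (x - y).
Proof. by move=> [_ hD hZ] hx hy; apply: hD => //; rewrite -scaleN1r; apply: hZ. Qed.

Section Ideals.
Variable R : comPzRingType.
Implicit Types I J K P : set R.

Lemma ideal0 J : is_ideal J -> J 0. Proof. by case. Qed.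
Lemma idealD J x y : is_ideal J -> J x -> J y -> J (x + y).
Proof. by case=> _ h _; apply: h. Qed.
Lemma idealMl J r x : is_ideal J -> J x -> J (r * x).
Proof. by case=> _ _ h; apply: h. Qed.
Lemma idealMxr J r x : is_ideal J -> J x -> J (x * r).
Proof. by rewrite mulrC; apply: idealMl. Qed.
Lemma idealB J x y : is_ideal J -> J x -> J y -> J (x - y).
Proof. exact: submodB. Qed.
Lemma ideal_sum J (T : Type) (s : seq T) (Q : pred T) (F : T -> R) :
  is_ideal J -> (forall t, Q t -> J (F t)) -> J (\sum_(t <- s | Q t) F t).
Proof.
move=> hJ h; apply: (big_ind J) => //; first exact: ideal0.
by move=> x y; apply: idealD.
Qed.

Lemma is_idealT : is_ideal [set: R]. Proof. by split. Qed.

Lemma ideal_gen_sub (X : set R) J : is_ideal J -> X `<=` J -> ideal_gen X `<=` J.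
Proof. exact: smallest_sub. Qed.

Lemma sub_ideal_gen (X : set R) : X `<=` ideal_gen X.
Proof. exact: sub_gen_smallest. Qed.

Lemma ideal_genS (X Y : set R) : X `<=` Y -> ideal_gen X `<=` ideal_gen Y.
Proof.
move=> h; apply: ideal_gen_sub; first exact: is_ideal_gen.
exact: subset_trans h (@sub_ideal_gen Y).
Qed.

Lemma ideal_gen_nil : ideal_gen [set` [::] : seq R] = [set 0].
Proof.
apply/seteqP; split=> [|x ->]; last exact: ideal0 (@is_ideal_gen _ _).
apply: ideal_gen_sub; last by move=> x /=; rewrite in_nil.
split=> [//|x y -> ->|r x ->]; first by rewrite /= addr0.
by rewrite /= -[LHS]/(r * 0) mulr0.
Qed.

Definition adjoin J x : set R := [set z | exists r u, J u /\ z = r * x + u].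

Lemma is_ideal_adjoin J x : is_ideal J -> is_ideal (adjoin J x).
Proof.
move=> hJ; split.
- by exists 0, 0; rewrite mul0r addr0; split=> //; apply: ideal0.
- move=> _ _ [r [u [hu ->]]] [r' [u' [hu' ->]]]; exists (r + r'), (u + u').
  by split; [apply: idealD|rewrite mulrDl addrACA].
- move=> a _ [r [u [hu ->]]]; exists (a * r), (a * u).
  by split; [apply: idealMl|rewrite -[LHS]/(a * _) mulrDr mulrA].
Qed.

Lemma adjoin_sub J x : J `<=` adjoin J x.
Proof. by move=> u hu; exists 0, u; rewrite mul0r add0r. Qed.

Lemma adjoin_mem J x : is_ideal J -> adjoin J x x.
Proof. by move=> hJ; exists 1, 0; split; [apply: ideal0|rewrite mul1r addr0]. Qed.

Lemma adjoin_min J x K : is_ideal K -> J `<=` K -> K x -> adjoin J x `<=` K.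
Proof.
move=> hK hJK hx _ [r [u [hu ->]]]; apply: idealD => //; first exact: idealMl.
exact: hJK.
Qed.

Lemma ideal_gen_cons x (s : seq R) :
  ideal_gen [set` x :: s] = adjoin (ideal_gen [set` s]) x.
Proof.
have hs := @is_ideal_gen R [set` s].
apply/seteqP; split.
  apply: ideal_gen_sub; first exact: is_ideal_adjoin.
  move=> y /=; rewrite inE => /predU1P[->|ys]; first exact: adjoin_mem.
  by apply: adjoin_sub; apply: sub_ideal_gen.
apply: adjoin_min; first exact: is_ideal_gen.
  by apply: ideal_genS => y /= ys; rewrite inE ys orbT.
by apply: sub_ideal_gen; rewrite /= mem_head.
Qed.

Lemma ideal_gen_seqP (s : seq R) z : ideal_gen [set` s] z ->
  exists c : nat -> R, z = \sum_(i < size s) c i * s`_i.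
Proof.
elim: s z => [|x s IH] z.
  by rewrite ideal_gen_nil => ->; exists (fun=> 0); rewrite big_ord0.
rewrite ideal_gen_cons => -[r [u [/IH[c ->] ->]]].
exists (fun i => if i is j.+1 then c j else r).
by rewrite big_ord_recl.
Qed.

Lemma ideal_expS I k : ideal_exp I k.+1 = ideal_mul I (ideal_exp I k).
Proof. by []. Qed.

Lemma ideal_expS_sub I k J : is_ideal J ->
  (forall x y, I x -> ideal_exp I k y -> J (x * y)) -> ideal_exp I k.+1 `<=` J.
Proof.
move=> hJ h; rewrite ideal_expS; apply: ideal_gen_sub => // _ [x [y [hx hy ->]]].
exact: h.
Qed.

Lemma ideal_expSM I k x y : I x -> ideal_exp I k y -> ideal_exp I k.+1 (x * y).
Proof.
by move=> hx hy; rewrite ideal_expS; apply: sub_ideal_gen; exists x, y.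
Qed.

Lemma ideal_exp1 I : is_ideal I -> ideal_exp I 1 = I.
Proof.
move=> hI; apply/seteqP; split.
  by apply: ideal_expS_sub => // x y hx _; apply: idealMxr.
by move=> x hx; rewrite -[x]mulr1; apply: ideal_expSM.
Qed.

Lemma ideal_expX I k x : I x -> ideal_exp I k (x ^+ k).
Proof. by move=> hx; elim: k => // k IH; rewrite exprS; apply: ideal_expSM. Qed.

Lemma ideal_exp_anti I a b : (a <= b)%N -> ideal_exp I b `<=` ideal_exp I a.
Proof.
move=> /subnK <-; elim: (b - a)%N => // k IH; rewrite addSn.
apply: ideal_expS_sub; first exact: is_ideal_exp.
by move=> x y _ /IH; apply: ideal_expZ.
Qed.

Lemma ideal_exp_sub I k : is_ideal I -> (0 < k)%N -> ideal_exp I k `<=` I.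
Proof. by move=> hI hk; rewrite -{2}(ideal_exp1 hI); apply: ideal_exp_anti. Qed.

Lemma ideal_expD_sub I a b J : is_ideal J ->
  (forall x y, ideal_exp I a x -> ideal_exp I b y -> J (x * y)) ->
  ideal_exp I (a + b) `<=` J.
Proof.
move=> hJ; elim: a b => [|a IH] b h.
  by move=> x hx; rewrite -[x]mul1r; apply: h.
rewrite addSnnS; apply: IH => x z hx; move: z.
apply: (@ideal_expS_sub _ _ [set z | J (x * z)]).
  split=> [|u v hu hv|r u hu] /=.
  - by rewrite mulr0; apply: ideal0.
  - by rewrite mulrDr; apply: idealD.
  - by rewrite -[r *: u]/(r * u) mulrCA; apply: idealMl.
move=> y z hy hz /=; rewrite mulrA [x * y]mulrC; apply: h => //.
exact: ideal_expSM.
Qed.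

Lemma ideal_expS_mono I J k : I `<=` J -> ideal_exp I k `<=` ideal_exp J k.
Proof.
move=> hIJ; elim: k => // k IH; apply: ideal_expS_sub; first exact: is_ideal_exp.
by move=> x y /hIJ hx /IH hy; apply: ideal_expSM.
Qed.

Lemma ideal_exp_exp I p k : ideal_exp (ideal_exp I p) k = ideal_exp I (p * k).
Proof.
elim: k => [|k IH]; first by rewrite muln0.
apply/seteqP; split.
  apply: ideal_expS_sub; first exact: is_ideal_exp.
  by move=> x y hx; rewrite IH mulnS; apply: ideal_exp_mul.
rewrite mulnS; apply: ideal_expD_sub; first exact: is_ideal_exp.
by move=> x y hx; rewrite -IH; apply: ideal_expSM.
Qed.

Lemma ideal_expS_gen (s : seq R) k J : is_ideal J ->
  (forall x y, x \in s -> ideal_exp (ideal_gen [set` s]) k y -> J (x * y)) ->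
  ideal_exp (ideal_gen [set` s]) k.+1 `<=` J.
Proof.
move=> hJ h; apply: ideal_expS_sub => // x y + hy.
apply: (@ideal_gen_sub _ [set x | J (x * y)]); last by move=> z hz; apply: h.
split=> [|u v hu hv|r u hu] /=.
- by rewrite mul0r; apply: ideal0.
- by rewrite mulrDl; apply: idealD.
- by rewrite -[r *: u]/(r * u) -mulrA; apply: idealMl.
Qed.

Lemma ideal_exp_adjoin J x k : is_ideal J ->
  ideal_exp (adjoin J x) k `<=`
  ideal_gen [set z | exists i v, [/\ (i <= k)%N, ideal_exp J (k - i) v & z = x ^+ i * v]].
Proof.
move=> hJ; elim: k => [|k IH] z.
  move=> _; apply: sub_ideal_gen; exists 0%N, z; split=> //.
  by rewrite expr0 mul1r.
move: z; apply: ideal_expS_sub; first exact: is_ideal_gen.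
move=> _ z [r [u [hu ->]]] /IH.
move: z; apply: ideal_gen_sub.
  split=> [|a b ha hb|a b ha].
  - by rewrite mulr0; exact: ideal0 (@is_ideal_gen _ _).
  - by rewrite mulrDr; apply: (idealD (@is_ideal_gen _ _)).
  - by rewrite -[a *: b]/(a * b) mulrCA; apply: (idealMl _ (@is_ideal_gen _ _)).
move=> _ [i [v [hi hv ->]]]; rewrite mulrDl; apply: (idealD (@is_ideal_gen _ _)).
- rewrite -mulrA; apply: (idealMl _ (@is_ideal_gen _ _)).
  by apply: sub_ideal_gen; exists i.+1, v; split=> //; rewrite mulrA exprS.
- apply: sub_ideal_gen; exists i, (u * v); split.
  + exact: leqW.
  + by rewrite subSn //; apply: ideal_expSM.
  + by rewrite mulrCA.
Qed.

(* For constant Q: an ideal is nilpotent modulo Q when its generators are. *)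
Lemma graded_nilpotent (s : seq R) (Q : nat -> set R) :
  (forall k, is_ideal (Q k)) ->
  (forall k x y, x \in s -> Q k y -> Q k.+1 (x * y)) ->
  (forall x, x \in s -> exists p, Q p (x ^+ p)) ->
  exists N, ideal_exp (ideal_gen [set` s]) N `<=` Q N.
Proof.
elim: s Q => [|x s IH] Q hQ hS hp.
  exists 1%N; rewrite ideal_exp1; last exact: is_ideal_gen.
  by rewrite ideal_gen_nil => _ ->; apply: ideal0.
have hJ := @is_ideal_gen R [set` s].
have hS' k y z : y \in s -> Q k z -> Q k.+1 (y * z).
  by move=> ys; apply: hS; rewrite inE ys orbT.
have [|N hN] := IH Q hQ hS'.
  by move=> y ys; apply: hp; rewrite inE ys orbT.
have hmono k : (N <= k)%N -> ideal_exp (ideal_gen [set` s]) k `<=` Q k.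
  move=> /subnK <-; elim: (k - N)%N => // i IHi; rewrite addSn.
  by apply: ideal_expS_gen => // y z ys /IHi; apply: hS'.
have [p hxp] := hp x (mem_head _ _).
have hxi i k z : Q k z -> Q (i + k)%N (x ^+ i * z).
  move=> hz; elim: i => [|i IHi]; first by rewrite expr0 mul1r.
  by rewrite exprS -mulrA addSn; apply: hS => //; rewrite mem_head.
(* Pigeonhole on the terms [x ^+ i * v] of degree [N + p]: for [i <= p] the factor [v] has degree at
   least [N]; otherwise [x ^+ p] splits off. *)
exists (N + p)%N; rewrite ideal_gen_cons.
apply: subset_trans (@ideal_exp_adjoin _ x _ hJ) _.
apply: ideal_gen_sub => // _ [i [v [hi hv ->]]].
have [hip|hip] := leqP i p.
  have {1}-> : (N + p = i + (N + p - i))%N by rewrite subnKC.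
  apply: hxi; apply: hmono => //; first by lia.
have -> : x ^+ i * v = x ^+ (i - p) * (v * x ^+ p).
  by rewrite mulrCA -exprD subnK ?(ltnW hip) // mulrC.
have -> : (N + p = (i - p) + (N + p - i + p))%N by lia.
apply: hxi; move: v hv; set q := (N + p - i)%N.
have : ideal_exp (ideal_gen [set` s]) 0 1 by [].
elim: q => [|q IHq] _ v hv; first exact: idealMl.
move: v hv; apply: (@ideal_expS_gen _ _ [set v | Q (q.+1 + p)%N (v * x ^+ p)]).
  split=> [|u v hu hv|r u hu] /=.
  - by rewrite mul0r; apply: ideal0.
  - by rewrite mulrDl; apply: idealD.
  - by rewrite -[r *: u]/(r * u) -mulrA; apply: idealMl.
by move=> y z ys hz /=; rewrite -mulrA; apply: hS' => //; apply: IHq.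
Qed.

Definition acc : Prop := forall c : nat -> set R,
  (forall i, is_ideal (c i)) -> (forall i, c i `<=` c i.+1) ->
  exists n, forall k, (n <= k)%N -> c k = c n.

Lemma chain_mono T (c : nat -> set T) : (forall i, c i `<=` c i.+1) ->
  forall i j, (i <= j)%N -> c i `<=` c j.
Proof.
move=> h i j /subnK <-; elim: (j - i)%N => // k IH; rewrite addSn.
exact: subset_trans IH (h _).
Qed.

Lemma noetherian_acc : noetherian R -> acc.
Proof.
move=> hN c hc hS; have hm := chain_mono hS.
have hU : is_ideal (\bigcup_i c i).
  split=> [|x y [i _ hx] [j _ hy]|r x [i _ hx]].
  - by exists 0%N => //; apply: ideal0.
  - exists (maxn i j) => //; apply: idealD => //.
      by apply: hm hx; rewrite leq_maxl.
    by apply: hm hy; rewrite leq_maxr.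
  - by exists i => //; apply: (@idealMl _ r).
have [s hs] := hN _ hU.
have [n hn] : exists n, [set` s] `<=` c n.
  have : [set` s] `<=` \bigcup_i c i by rewrite hs; apply: sub_ideal_gen.
  elim: s {hs} => [|x s IH] hs; first by exists 0%N.
  have [|n hn] := IH; first by move=> y ys; apply: hs; rewrite /= inE ys orbT.
  have [|i _ hi] := hs x; first by rewrite /= mem_head.
  exists (maxn n i) => y /=; rewrite inE => /predU1P[->|/hn].
    by apply: hm hi; rewrite leq_maxr.
  by apply: hm; rewrite leq_maxl.
exists n => k hk; apply/seteqP; split; last exact: hm.
have : c k `<=` \bigcup_i c i by apply: bigcup_sup.
rewrite hs => /subset_trans; apply; exact: ideal_gen_sub.
Qed.

Lemma acc_noetherian : acc -> noetherian R.
Proof.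
move=> hA I hI; apply: contrapT => /forallNP hs.
have next (s : seq R) : [set` s] `<=` I ->
    exists x, I x /\ ~ ideal_gen [set` s] x.
  move=> hsI; apply: contrapT => /forallNP h; apply: (hs s).
  apply/seteqP; split; last exact: ideal_gen_sub.
  by move=> x hx; apply: contrapT => hnx; apply: (h x).
have /choice[f hf] : forall s : seq R, exists x,
    [set` s] `<=` I -> I x /\ ~ ideal_gen [set` s] x.
  move=> s; have [/next[x hx]|hn] := pselect ([set` s] `<=` I); first by exists x.
  by exists 0.
pose s n := iter n (fun s => f s :: s) [::].
have hsI n : [set` s n] `<=` I.
  elim: n => // n IH x /=; rewrite inE => /predU1P[->|]; last exact: IH.
  exact: (hf _ IH).1.
have [||n hn] := hA (fun n => ideal_gen [set` s n]).
- by move=> i; apply: is_ideal_gen.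
- by move=> i; apply: ideal_genS => x /= hx; rewrite inE hx orbT.
apply: (hf _ (hsI n)).2; rewrite -(hn n.+1) //; apply: sub_ideal_gen.
by rewrite /= mem_head.
Qed.

Lemma acc_max (F : set (set R)) : acc -> (forall J, F J -> is_ideal J) ->
  F !=set0 -> exists J, F J /\ forall K, F K -> J `<=` K -> K = J.
Proof.
move=> hA hF [J0 hJ0]; apply: contrapT => /forallNP hno.
have /choice[f hf] : forall J, exists K, F J -> F K /\ J `<` K.
  move=> J; have [hJ|] := pselect (F J); last by exists J.
  apply: contrapT => /forallNP h; apply: (hno J); split=> // K hK hJK.
  apply/seteqP; split=> //; apply: contrapT => hKJ; apply: (h K) => _.
  by split.
pose c n := iter n f J0.
have hc n : F (c n) by elim: n => // n IH; exact: (hf _ IH).1.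
have [||n hn] := hA c.
- by move=> i; apply/hF/hc.
- by move=> i; apply: properW; exact: (hf _ (hc i)).2.
have := (hf _ (hc n)).2; rewrite -[f (c n)]/(c n.+1) hn // => -[_]; exact.
Qed.

End Ideals.

(** * Noetherianity of the Rees algebra *)

Section HilbertBasis.
Variable R : comNzRingType.
Implicit Types J : set {poly R}.

Definition lead_ideal J n : set R :=
  [set a | exists p, [/\ J p, (size p <= n.+1)%N & a = p`_n]].

Lemma is_ideal_lead J n : is_ideal J -> is_ideal (lead_ideal J n).
Proof.
move=> hJ; split.
- by exists 0; rewrite size_poly0 coef0; split=> //; apply: ideal0.
- move=> _ _ [p [hp sp ->]] [q [hq sq ->]]; exists (p + q); split.
  + exact: idealD.
  + by rewrite (leq_trans (size_polyD _ _)) // geq_max sp sq.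
  + by rewrite coefD.
- move=> a _ [p [hp sp ->]]; exists (a%:P * p); split.
  + exact: idealMl.
  + by rewrite mul_polyC (leq_trans (size_scale_leq _ _)).
  + by rewrite coefCM.
Qed.

Lemma lead_idealS J n : is_ideal J -> lead_ideal J n `<=` lead_ideal J n.+1.
Proof.
move=> hJ _ [p [hp sp ->]]; exists ('X * p); split.
- exact: idealMl.
- rewrite mulrC; have [->|p0] := eqVneq p 0; first by rewrite mul0r size_poly0.
  by rewrite size_mulX.
- by rewrite coefXM.
Qed.

Lemma lead_ideal_mono J J' n : J `<=` J' -> lead_ideal J n `<=` lead_ideal J' n.
Proof. by move=> h _ [p [/h hp sp ->]]; exists p. Qed.

Lemma lead_ideal_eq J J' : is_ideal J -> is_ideal J' -> J `<=` J' ->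
  (forall n, lead_ideal J' n `<=` lead_ideal J n) -> J' = J.
Proof.
move=> hJ hJ' hs h; apply/seteqP; split=> // p.
have [n] := ubnP (size p); elim: n p => // n IH p hn hp.
case: n IH hn => [|n] IH hn.
  have -> : p = 0 by apply/eqP; rewrite -size_poly_eq0; case: (size p) hn.
  exact: ideal0.
have [|q [hq sq eq]] := h n p`_n; first by exists p.
rewrite -(subrK q p); apply: idealD => //; apply: IH; last first.
  by apply: idealB => //; apply: hs.
rewrite ltnS; apply/leq_sizeP => j; rewrite leq_eqVlt coefB => /predU1P[<-|hj].
  by rewrite eq subrr.
by rewrite (leq_sizeP _ _ (hn : (size p <= n.+1)%N)) // (leq_sizeP _ _ sq) // subrr.
Qed.

(** Hilbert's basis theorem. The diagonal chain [lead_ideal (c i) i] stabilises at some [d], which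
    settles all degrees from [d] on; the degrees below [d] give finitely many further chains in
    [R]. *)
Lemma acc_poly : acc R -> acc {poly R}.
Proof.
move=> hA c hc hS; have hm := chain_mono hS.
have hmn i j n k : (i <= j)%N -> (n <= k)%N ->
    lead_ideal (c i) n `<=` lead_ideal (c j) k.
  move=> hij hnk; apply: subset_trans (lead_ideal_mono (hm _ _ hij)) _.
  by apply: (chain_mono (c := lead_ideal (c j))) => // l; apply: lead_idealS.
have [||d hd] := hA (fun i => lead_ideal (c i) i).
- by move=> i; apply: is_ideal_lead.
- by move=> i; apply: hmn; rewrite leqnSn.
have /choice[f hf] : forall n, exists i, forall k, (i <= k)%N ->
    lead_ideal (c k) n = lead_ideal (c i) n.
  move=> n; apply: (hA (fun i => lead_ideal (c i) n)) => i; first exact: is_ideal_lead.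
  by apply: hmn; rewrite ?leqnSn.
pose N := maxn d (\max_(n < d) f n); exists N => k hk.
have hNd : (d <= N)%N by rewrite leq_maxl.
apply: lead_ideal_eq => //; first exact: hm.
move=> n; have [hn|hn] := ltnP n d.
  have hfN : (f n <= N)%N.
    by apply: leq_trans (leq_maxr _ _); apply: (bigmax_sup (Ordinal hn)).
  by rewrite hf ?(leq_trans hfN) // [X in _ `<=` X]hf.
apply: (@subset_trans _ (lead_ideal (c (maxn k n)) (maxn k n))).
  by apply: hmn; rewrite ?leq_maxl ?leq_maxr.
rewrite hd; last by rewrite (leq_trans hn) // leq_maxr.
by apply: hmn.
Qed.

End HilbertBasis.

Lemma acc_surj (R S : comPzRingType) (f : R -> S) :
  f 0 = 0 -> (forall x y, f (x + y) = f x + f y) ->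
  (forall x y, f (x * y) = f x * f y) -> (forall y, exists x, f x = y) ->
  acc R -> acc S.
Proof.
move=> f0 fD fM fs hA c hc hS.
have [||n hn] := hA (fun i => f @^-1` c i).
- move=> i; split=> [|x y hx hy|r x hx] /=.
  + by rewrite f0; apply: ideal0.
  + by rewrite fD; apply: idealD.
  + by rewrite -[r *: x]/(r * x) fM; apply: idealMl.
- by move=> i x; apply: hS.
exists n => k hk; have := hn k hk; rewrite !predeqE => h y.
by have [x <-] := fs y; apply: h.
Qed.

(* B is a quotient of an iterated polynomial ring over R. *)
Lemma acc_fin_gen (R B : comNzRingType) (f : {rmorphism R -> B}) (s : seq B) :
  acc R ->
  (forall C : set B, (forall a, C (f a)) -> (forall x, x \in s -> C x) ->
     (forall x y, C x -> C y -> C (x + y)) ->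
     (forall x y, C x -> C y -> C (x * y)) -> C = setT) ->
  acc B.
Proof.
move=> hR hgen.
suff [S [g [hS hf hs]]] : exists (S : comNzRingType) (g : {rmorphism S -> B}),
    [/\ acc S, forall a, exists x, g x = f a &
        forall y, y \in s -> exists x, g x = y].
  apply: (@acc_surj S B g) => //; [exact: rmorph0|exact: rmorphD|exact: rmorphM|].
  have hT : [set y | exists x, g x = y] = setT.
    apply: hgen => //= _ _ [x <-] [y <-].
      by exists (x + y); rewrite rmorphD.
    by exists (x * y); rewrite rmorphM.
  by move=> y; have : [set: B] y by []; rewrite -hT.
elim: s {hgen} => [|b s [S [g [hS hf hs]]]]; first by exists R, f; split=> // a; exists a.
have cgb : commr_rmorph g b by move=> x; apply: mulrC.
exists {poly S}, (horner_morph cgb); split.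
- exact: acc_poly.
- by move=> a; have [x <-] := hf a; exists x%:P; exact: horner_morphC.
- move=> y; rewrite inE => /predU1P[->|/hs[x <-]].
    by exists 'X; exact: horner_morphX.
  by exists x%:P; exact: horner_morphC.
Qed.

Section Rees.
Variables (A : comNzRingType) (I : set A).

(* a t^k, with junk value 0 when a is not in I^k *)
Definition rees_monom (k : nat) (a : A) : rees I :=
  if insub (a *: 'X^k : {poly A}) is Some p then p else 0.

Lemma val_rees_monom k a : ideal_exp I k a -> val (rees_monom k a) = a *: 'X^k.
Proof.
move=> ha; rewrite /rees_monom; case: insubP => [p _ ->//|/negP[]].
apply/reesP => i; rewrite coefZ coefXn; case: eqP => [->|_]; first by rewrite mulr1.
by rewrite mulr0; apply: ideal_exp0.
Qed.

Lemma rees_coef (p : rees I) i : ideal_exp I i (val p)`_i.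
Proof. by have /reesP := valP p. Qed.

Lemma rees_sum (p : rees I) :
  \sum_(i < size (val p)) rees_monom i (val p)`_i = p.
Proof.
apply: val_inj; rewrite raddf_sum /= -[RHS]coefK poly_def.
by apply: eq_bigr => i _; rewrite val_rees_monom //; apply: rees_coef.
Qed.

(** Finite generation: the elements [x t], for [x] in a finite generating set of [I], generate
    [A[It]] over [A]. *)
Lemma noetherian_rees : is_ideal I -> noetherian A -> acc (rees I).
Proof.
move=> hI hN; have [s hs] := hN _ hI.
have hsI x : x \in s -> ideal_exp I 1 x.
  by move=> xs; rewrite ideal_exp1 // hs; apply: sub_ideal_gen.
pose x1 := rees_monom 1; pose f := rees_monom 0.
have fD : zmod_morphism f by move=> a b; apply: val_inj; rewrite raddfB /= !val_rees_monom // scalerBl.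
have fM : monoid_morphism f.
  split=> [|a b]; apply: val_inj.
    by rewrite rmorph1 val_rees_monom // scale1r expr0.
  by rewrite rmorphM /= !val_rees_monom // expr0 !alg_polyC polyCM.
pose fZ := GRing.isZmodMorphism.Build _ _ f fD.
pose fMM := GRing.isMonoidMorphism.Build _ _ f fM.
pose g : {rmorphism A -> rees I} := HB.pack f fZ fMM.
have gE a : g a = rees_monom 0 a by [].
apply: (@acc_fin_gen A _ g [seq x1 x | x <- s]); first exact: noetherian_acc.
move=> C hC hx hD hM; apply/seteqP; split=> // p _.
have h1 : C 1 by rewrite -(rmorph1 g); apply: hC.
have hk k : forall c, ideal_exp I k c -> C (rees_monom k c).
  elim: k => [|k IH] c.
    by move=> _; have := hC c; congr C; apply: val_inj; rewrite val_rees_monom.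
  (* Membership in [I^(k+1)] is carried along because the junk value of [rees_monom] spoils
     additivity elsewhere. *)
  suff: ideal_exp I k.+1 `<=` [set c | ideal_exp I k.+1 c /\ C (rees_monom k.+1 c)].
    by move=> h /h[].
  rewrite [X in ideal_exp X _ `<=` _]hs; apply: ideal_expS_gen.
    split=> [|a b [ha hca] [hb hcb]|r a [ha hca]] /=.
    - split; first exact: ideal_exp0.
      have := hC 0; congr C; apply: val_inj.
      by rewrite gE !val_rees_monom ?scale0r //; apply: ideal_exp0.
    - have hab := ideal_expD ha hb; split=> //.
      have := hD _ _ hca hcb; congr C; apply: val_inj.
      by rewrite raddfD /= !val_rees_monom // scalerDl.
    - have hra := ideal_expZ r ha; split=> //.
      have := hM _ _ (hC r) hca; congr C; apply: val_inj.
      by rewrite gE rmorphM /= !val_rees_monom // expr0 alg_polyC mul_polyC scalerA.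
  move=> x y xs; rewrite -hs => hy.
  have hxy : ideal_exp I k.+1 (x * y).
    by apply: ideal_expSM => //; rewrite -(ideal_exp1 hI); apply: hsI.
  split=> //; have := hM _ _ (hx _ (map_f _ xs)) (IH _ hy); congr C; apply: val_inj.
  rewrite rmorphM /= !val_rees_monom //; last exact: hsI.
  by rewrite -scalerAl -scalerAr scalerA -exprD.
rewrite -[p]rees_sum; apply: big_ind => //.
- by rewrite -(rmorph0 g).
- by move=> i _; apply: hk; apply: rees_coef.
Qed.

End Rees.

Section Families.
Variables (A : comNzRingType) (I : set A).
Implicit Types a b : nat -> set A.

(* Homogeneous ideals of the Rees algebra, given by their components *)
Definition rees_family a : Prop :=
  [/\ forall k, is_ideal (a k), forall k, a k `<=` ideal_exp I k &
      forall k x y, I x -> a k y -> a k.+1 (x * y)].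

Definition rees_ideal a : set (rees I) := [set p : rees I | forall k, a k (val p)`_k].

Lemma rees_family_exp a i k x y : rees_family a ->
  ideal_exp I i x -> a k y -> a (i + k)%N (x * y).
Proof.
case=> ha _ hM hx hy; move: x hx; elim: i => [|i IH] x hx.
  exact: idealMl.
move: x hx; rewrite addSn.
apply: (@ideal_expS_sub _ _ _ [set x | a (i + k).+1 (x * y)]).
  split=> [|u v hu hv|r u hu] /=.
  - by rewrite mul0r; apply: ideal0.
  - by rewrite mulrDl; apply: idealD.
  - by rewrite -[r *: u]/(r * u) -mulrA; apply: idealMl.
by move=> x z hx /IH hz /=; rewrite -mulrA; apply: hM.
Qed.

Lemma is_ideal_rees_ideal a : rees_family a -> is_ideal (rees_ideal a).
Proof.
move=> hfa; have [ha _ hM] := hfa; split=> [|p q hp hq|r p hp] k.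
- by rewrite raddf0 coef0; apply: ideal0.
- by rewrite raddfD coefD; apply: idealD.
- rewrite -[r *: p]/(r * p) rmorphM coefM; apply: ideal_sum => // j _.
  have {1}-> : k = (j + (k - j))%N by rewrite subnKC // -ltnS.
  by apply: rees_family_exp => //; apply: rees_coef.
Qed.

Lemma rees_ideal_monom a k x : rees_family a -> a k x ->
  rees_ideal a (rees_monom I k x).
Proof.
move=> [ha hI _] hx j; rewrite val_rees_monom; last exact: hI.
rewrite coefZ coefXn; case: eqP => [->|_]; first by rewrite mulr1.
by rewrite mulr0; apply: ideal0.
Qed.

Lemma rees_ideal_inj a b k : rees_family a ->
  rees_ideal a `<=` rees_ideal b -> a k `<=` b k.
Proof.
move=> ha h x hx; have := h _ (rees_ideal_monom ha hx) k.
rewrite val_rees_monom; last by have [_ + _] := ha; apply.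
by rewrite coefZ coefXn eqxx mulr1.
Qed.

(** Noetherian induction over homogeneous ideals: above a maximal counterexample every strictly
    larger family satisfies [P]. *)
Lemma rees_family_ind (P : (nat -> set A) -> Prop) : acc (rees I) ->
  (forall a, rees_family a ->
     (forall b, rees_family b -> (forall k, a k `<=` b k) ->
        (exists k, ~ (b k `<=` a k)) -> P b) -> P a) ->
  forall a, rees_family a -> P a.
Proof.
move=> hA hP a ha; apply: contrapT => hn.
have [||J [[b [hb hnb ->]] hmax]] :=
    @acc_max _ [set J | exists b, [/\ rees_family b, ~ P b & J = rees_ideal b]] hA.
- by move=> _ [b [hb _ ->]]; apply: is_ideal_rees_ideal.
- by exists (rees_ideal a), a.
apply: hnb; apply: hP => // b' hb' hbb' [k hk]; apply: contrapT => hnb'.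
apply: hk; apply: rees_ideal_inj => //.
rewrite (hmax (rees_ideal b')) //; first by exists b'.
by move=> p hp j; apply/hbb'/hp.
Qed.

Lemma rees_family_fg a : acc (rees I) -> rees_family a ->
  exists n, forall k J, (n <= k)%N -> is_ideal J ->
    (forall x y, I x -> a k y -> J (x * y)) -> a k.+1 `<=` J.
Proof.
move=> hA hfa; have [ha hI hM] := hfa.
have [s hs] := acc_noetherian hA (is_ideal_rees_ideal hfa).
have hsa p : p \in s -> rees_ideal a p by rewrite hs => ?; apply: sub_ideal_gen.
exists (\max_(p <- s) size (val p)) => k J hk hJ h c hc.
have := rees_ideal_monom hfa hc; rewrite hs => /ideal_gen_seqP[r /(congr1 val)].
rewrite val_rees_monom; last exact: hI.
move=> /(congr1 (fun p : {poly A} => p`_k.+1)).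
rewrite coefZ coefXn eqxx mulr1 raddf_sum /= coef_sum => ->.
apply: ideal_sum => // i _; rewrite coefMr; apply: ideal_sum => // j _.
have hsi : nth 0 s i \in s by rewrite mem_nth.
(* Coefficients of index [j > k] of a generator vanish by the choice of the bound; for [j <= k] the
   cofactor has positive degree [k + 1 - j], so a factor in [I] splits off. *)
have [hjk|hjk] := leqP j k; last first.
  rewrite [X in _ * X]nth_default ?mulr0; first exact: ideal0.
  apply: leq_trans (ltnW hjk); apply: leq_trans hk.
  by rewrite (big_rem _ hsi) /= leq_maxl.
have := hsa _ hsi j; move: (val _)`_j => y hy.
have : ideal_exp I (k.+1 - j) ((val (r i))`_(k.+1 - j)) by apply: rees_coef.
rewrite subSn //; move: (_`__).
apply: (@ideal_expS_sub _ _ _ [set x | J (x * y)]).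
  split=> [|u v hu hv|z u hu] /=.
  - by rewrite mul0r; apply: ideal0.
  - by rewrite mulrDl; apply: idealD.
  - by rewrite -[z *: u]/(z * u) -mulrA; apply: idealMl.
move=> x z hx hz /=; rewrite -mulrA; apply: h => //.
by rewrite -(subnK hjk); apply: rees_family_exp.
Qed.

End Families.

Lemma acc_gr (A : comNzRingType) (I : set A) : acc (rees I) -> acc (gr I).
Proof.
apply: (@acc_surj _ _ \pi_(gr I)).
- exact: raddf0.
- exact: raddfD.
- exact: pi_gr_mul.
- by move=> y; exists (repr y); rewrite reprK.
Qed.

(** * Local rings, prime chains and parameter ideals *)

Section LocalRings.
Variable R : comPzRingType.
Implicit Types I J K P m : set R.

Lemma local_sub m J : acc R -> local_ring m -> is_ideal J -> ~ J 1 -> J `<=` m.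
Proof.
move=> hA [_ hm] hJ hJ1.
have [||P [[hP hP1 hJP] hmax]] :=
    @acc_max _ [set P | [/\ is_ideal P, ~ P 1 & J `<=` P]] hA.
- by move=> P [].
- by exists J; split=> // x.
suff <- : P = m by [].
apply: hm; split=> // K hK hK1 hPK; apply: hmax => //; split=> //.
exact: subset_trans hPK.
Qed.

Lemma local_unit m x : acc R -> local_ring m -> ~ m x -> exists y, y * x = 1.
Proof.
move=> hA hm hx; apply: contrapT => hn; apply: hx.
have h0 : is_ideal [set 0 : R] by rewrite -ideal_gen_nil; apply: is_ideal_gen.
apply: (local_sub hA hm (is_ideal_adjoin x h0)); last exact: adjoin_mem.
by move=> [r [u [-> hru]]]; apply: hn; exists r; rewrite hru addr0.
Qed.

Lemma prime_avoiding J (T : set R) : acc R -> is_ideal J ->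
  T 1 -> (forall x y, T x -> T y -> T (x * y)) -> (forall x, J x -> ~ T x) ->
  exists P, [/\ prime_ideal P, J `<=` P & forall x, P x -> ~ T x].
Proof.
move=> hA hJ hT1 hTM hJT.
have [||P [[hP hJP hPT] hmax]] :=
    @acc_max _ [set P | [/\ is_ideal P, J `<=` P & forall x, P x -> ~ T x]] hA.
- by move=> P [].
- by exists J; split=> // x.
exists P; split=> //; split=> // [/hPT//|x y hxy].
have hit z : ~ P z -> exists r u, P u /\ T (r * z + u).
  move=> hz; apply: contrapT => hn; apply: hz; rewrite -(hmax (adjoin P z)).
  - exact: adjoin_mem.
  - split; first exact: is_ideal_adjoin.
      exact: subset_trans hJP (@adjoin_sub _ _ _).
    by move=> _ [r [u [hu ->]]] ht; apply: hn; exists r, u.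
  - exact: adjoin_sub.
apply: contrapT => /not_orP[/hit[r [u [hu ht]]] /hit[r' [u' [hu' ht']]]].
apply: (hPT _ _ (hTM _ _ ht ht')); rewrite mulrDl; apply: idealD => //.
  rewrite mulrDr; apply: idealD => //; last exact: idealMl.
  by rewrite mulrACA; apply: idealMl.
exact: idealMxr.
Qed.

Lemma primary_to_local m K : acc R -> local_ring m ->
  is_ideal K -> ~ K 1 -> (exists N, ideal_exp m N `<=` K) -> primary_to m K.
Proof.
move=> hA hm hK hK1 [N hN].
have hr : radical K = m.
  apply/seteqP; split=> [x [n hx]|x hx]; last by exists N; apply/hN/ideal_expX.
  apply: contrapT => /(local_unit hA hm)[y hy]; apply: hK1.
  by rewrite -(expr1n _ n) -hy exprMn; apply: idealMl.
split=> //; split=> // x y hxy; rewrite hr.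
have [|/(local_unit hA hm)[z hz]] := pselect (m y); [by right|left].
by rewrite -[x]mulr1 -hz mulrCA; apply: idealMl.
Qed.

Lemma primary_to_exp m K : acc R -> is_ideal m -> primary_to m K ->
  exists N, ideal_exp m N `<=` K.
Proof.
move=> hA hm [[hK _ _] hr]; have [s hs] := acc_noetherian hA hm.
have [||x xs|N hN] := @graded_nilpotent _ s (fun=> K).
- by [].
- by move=> _ x y _; apply: idealMl.
- suff : radical K x by [].
  by rewrite hr hs; apply: sub_ideal_gen.
- by exists N; rewrite {1}hs.
Qed.

(** Instead of localising at [P], avoid the products [t * x ^+ n] with [t] outside [P]: a prime
    avoiding them lies in [P] and misses [x]. Regularity of the sequence makes this multiplicative
    set disjoint from the ideal of the preceding elements. *)
Lemma prime_chain_regular (s : seq R) P i : acc R -> (i <= size s)%N ->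
  regular_sequence s -> prime_ideal P -> ideal_gen [set` take i s] `<=` P ->
  exists c : nat -> set R, [/\ forall j, (j <= i)%N -> prime_ideal (c j),
    forall j, (j < i)%N -> c j `<` c j.+1 & c i = P].
Proof.
move=> hA + [_ hreg]; elim: i P => [|i IH] P hi hP hsP; first by exists (fun=> P).
have [hPi hP1 hPM] := hP; pose x := s`_i.
have hsub : ideal_gen [set` take i s] `<=` P.
  apply: subset_trans hsP; apply: ideal_genS => y /=.
  by rewrite (take_nth 0) // mem_rcons inE => ->; rewrite orbT.
have [|||P' [hP' hsP' hPT]] := @prime_avoiding (ideal_gen [set` take i s])
    [set z | exists t n, ~ P t /\ z = t * x ^+ n] hA (@is_ideal_gen _ _).
- by exists 1, 0%N; rewrite mul1r.
- move=> _ _ [t [n [ht ->]]] [t' [n' [ht' ->]]]; exists (t * t'), (n + n')%N.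
  by split; [move=> /hPM[]|rewrite mulrACA exprD].
- move=> z hz [t [n [ht hzt]]]; apply/ht/hsub.
  move: hz; rewrite hzt; elim: n {hzt} => [|n IHn]; first by rewrite expr0 mulr1.
  by rewrite exprS mulrCA => /hreg-/(_ hi); apply: IHn.
have [c [hc hcS hci]] := IH P' (ltnW hi) hP' hsP'.
exists (fun j => if (j <= i)%N then c j else P); split=> [j _|j hj|].
- by case: ifP => // /hc.
- rewrite -ltnS hj; case: ifP => hji; first by apply: hcS.
  have -> : j = i by lia.
  rewrite hci; split.
    move=> y hy; apply: contrapT => hPy; apply: (hPT _ hy).
    by exists y, 0%N; rewrite mulr1.
  move=> /(_ x); have hPx : P x.
    apply: hsP; apply: sub_ideal_gen => /=.
    by rewrite (take_nth 0) // mem_rcons mem_head.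
  by move=> /(_ hPx) /hPT; apply; exists 1, 1%N; rewrite mul1r.
- by rewrite ltnn.
Qed.

(** A prime over the regular sequence other than [m] would lie, by [prime_chain_regular], in a chain
    of [d + 1] strict inclusions ending at [m]. So [m] is the only prime over it, and every element
    of [m] has a power in the ideal. *)
Lemma CM_parameter_ideal m d : CM_local_ring m d ->
  exists s : seq R, [/\ regular_sequence s, [set` s] `<=` m, size s = d &
    exists N, ideal_exp m N `<=` ideal_gen [set` s]].
Proof.
move=> [hN hloc [_ hdim] [[s [hreg hsm hs]] _]]; have hA := noetherian_acc hN.
exists s; split=> //; set q := ideal_gen [set` s].
have [[hm hm1 _] _] := hloc.
have hq : is_ideal q by apply: is_ideal_gen.
have hqm : q `<=` m by apply: ideal_gen_sub.
have hprime P : prime_ideal P -> q `<=` P -> P = m.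
  move=> hP hqP; have [hPi hP1 _] := hP.
  have hPm := local_sub hA hloc hPi hP1.
  apply/seteqP; split=> //; apply: contrapT => hmP.
  have [|c [hc hcS hcd]] := prime_chain_regular hA (leqnn _) hreg hP.
    by rewrite take_size.
  have : (d.+1 <= d)%N; last by rewrite ltnn.
  apply: hdim; exists (fun j => if (j <= d)%N then c j else m); split=> j hj.
    case: ifP => [hjd|_]; first by apply: hc; rewrite hs.
    split=> // x y hxy.
    have [|/(local_unit hA hloc)[z hz]] := pselect (m y); [by right|left].
    by rewrite -[x]mulr1 -hz mulrCA; apply: idealMl.
  rewrite -ltnS hj; case: ifP => hjd; first by apply: hcS; rewrite hs.
  have -> : j = d by lia.
  by rewrite -hs hcd.
have hrad : m `<=` radical q.
  move=> x hx; apply: contrapT => hn.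
  have [||z hz|P [hP hqP hPT]] := @prime_avoiding q [set z | exists n, z = x ^+ n] hA hq.
  - by exists 0%N.
  - by move=> _ _ [n ->] [n' ->]; exists (n + n')%N; rewrite exprD.
  - by move=> [n hzn]; apply: hn; exists n; rewrite /= -hzn.
  - apply: (hPT x); last by exists 1%N.
    by rewrite (hprime P).
have [t ht] := hN m hm.
have [||x xt|N hN'] := @graded_nilpotent _ t (fun=> q).
- by [].
- by move=> _ x y _; apply: idealMl.
- by apply: (hrad x); rewrite ht; apply: sub_ideal_gen.
- by exists N; rewrite {1}ht.
Qed.

End LocalRings.

(** * Length *)

Lemma properx_sub T (X Y Z : set T) : X `<` Y -> Y `<=` Z -> X `<` Z.
Proof.
move=> [hXY hYX] hYZ; split; first exact: subset_trans hYZ.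
by move=> hZX; apply: hYX; apply: subset_trans hZX.
Qed.

Section Length.
Variables (R : pzRingType) (M : lmodType R).
Implicit Types N P Q : set M.

Lemma has_chain0 N1 N2 : is_submodule N1 -> N1 `<=` N2 -> has_chain N1 N2 0.
Proof. by move=> h1 h12; exists (fun=> N1); split=> // i _; split. Qed.

Lemma has_chain_sub N1 N2 N1' N2' n : N1 `<=` N1' -> N2' `<=` N2 ->
  has_chain N1' N2' n -> has_chain N1 N2 n.
Proof.
move=> h1 h2 [c [hc hS]]; exists c; split=> // i /hc[hs h1c hc2].
by split=> //; [apply: subset_trans h1c|apply: subset_trans h2].
Qed.

Lemma has_chain_cat N1 N2 N3 i j : N1 `<=` N2 -> N2 `<=` N3 ->
  has_chain N1 N2 i -> has_chain N2 N3 j -> has_chain N1 N3 (i + j).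
Proof.
move=> h12 h23 [c [hc hS]] [c' [hc' hS']].
exists (fun k => if (k < i)%N then c k else c' (k - i)%N); split=> k hk.
  case: ifP => hki.
    by have [hs ? h] := hc k (ltnW hki); split=> //; apply: subset_trans h23.
  have [|hs h ?] := hc' (k - i)%N; first by lia.
  by split=> //; apply: subset_trans h.
have [hki|hki] := ltnP k i; last first.
  rewrite ltnNge (leqW hki) /= subSn //; apply: hS'; lia.
case: ifP => hki'; first exact: hS.
have eki : k.+1 = i by lia.
apply: (properx_sub (hS _ hki)); rewrite eki subnn.
have [_ _ h2] := hc i (leqnn _); have [//|_ h2' _] := hc' 0%N.
exact: subset_trans h2'.
Qed.

Definition sum_set N P : set M := [set z | exists x y, [/\ N x, P y & z = x + y]].

Lemma is_submodule_sum N P : is_submodule N -> is_submodule P ->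
  is_submodule (sum_set N P).
Proof.
move=> [hN0 hND hNZ] [hP0 hPD hPZ]; split.
- by exists 0, 0; rewrite addr0.
- move=> _ _ [x [y [hx hy ->]]] [x' [y' [hx' hy' ->]]].
  by exists (x + x'), (y + y'); rewrite addrACA; split; auto.
- by move=> r _ [x [y [hx hy ->]]]; exists (r *: x), (r *: y); rewrite scalerDr; split; auto.
Qed.

Lemma is_submodule_cap N P : is_submodule N -> is_submodule P ->
  is_submodule (N `&` P).
Proof.
move=> [hN0 hND hNZ] [hP0 hPD hPZ]; split=> [//|x y [? ?] [? ?]|r x [? ?]].
  by split; auto.
by split; auto.
Qed.

Lemma has_chain_rcons N1 N2 P n : is_submodule N2 -> is_submodule P ->
  N1 `<=` N2 -> N2 `<` P -> has_chain N1 N2 n -> has_chain N1 P n.+1.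
Proof.
move=> h2 hP h12 h2P hc; rewrite -addn1.
apply: has_chain_cat (hc) _ => //; first exact: properW.
exists (fun k => if k is 0%N then N2 else P); split=> [[|k] _|[|k]] //.
  by split=> //; apply: properW.
by split=> //; apply: properW.
Qed.

(* Modular law: each step of a chain is strict after intersection with N2 or
   after adding N2. *)
Lemma has_chain_split N1 N2 N3 n : is_submodule N1 -> is_submodule N2 ->
  is_submodule N3 -> N1 `<=` N2 -> N2 `<=` N3 -> has_chain N1 N3 n ->
  exists i j, [/\ has_chain N1 N2 i, has_chain N2 N3 j & (n <= i + j)%N].
Proof.
move=> h1 h2 h3 h12 h23 [c [hc hS]].
suff: forall k, (k <= n)%N -> exists i j, [/\ has_chain N1 (c k `&` N2) i,
    has_chain N2 (sum_set (c k) N2) j & (k <= i + j)%N].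
  move=> /(_ n (leqnn _))[i [j [hi hj hn]]]; exists i, j; split=> //.
    exact: has_chain_sub hi.
  apply: has_chain_sub hj => // _ [x [y [hx hy ->]]].
  have [_ hD _] := h3; have [_ _ hcn] := hc n (leqnn _).
  by apply: hD; [apply: hcn|apply: h23].
elim=> [_|k IH hk].
  have [//|hc0 h1c hc3] := hc 0%N; exists 0%N, 0%N; split=> //.
    by apply: has_chain0 => // x hx; split; [apply: h1c|apply: h12].
  by apply: has_chain0 => // x hx; exists 0, x; rewrite add0r; split=> //; case: hc0.
have [i [j [hi hj hkij]]] := IH (ltnW hk).
have [hck h1k _] := hc k (ltnW hk); have [hcS _ _] := hc k.+1 hk.
have [hsub hnsub] := hS k hk.
have hcap : c k `&` N2 `<=` c k.+1 `&` N2 by move=> x [/hsub].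
have hsum : sum_set (c k) N2 `<=` sum_set (c k.+1) N2.
  by move=> _ [x [y [/hsub ? ? ->]]]; exists x, y.
have [hcap'|hcap'] := pselect (c k.+1 `&` N2 `<=` c k `&` N2); last first.
  exists i.+1, j; split=> //.
  - apply: has_chain_rcons hi => //.
    + exact: is_submodule_cap.
    + exact: is_submodule_cap.
    + by move=> x hx; split; [apply: h1k|apply: h12].
  - exact: has_chain_sub hj.
exists i, j.+1; split=> //; last by rewrite addnS.
  exact: has_chain_sub hi.
apply: has_chain_rcons hj => //.
- exact: is_submodule_sum.
- exact: is_submodule_sum.
- by move=> x hx; exists 0, x; rewrite add0r; split=> //; case: hck.
split=> // hsum'; apply: hnsub => x hx.
have [|y [z [hy hz exyz]]] := hsum' x.
  by exists x, 0; rewrite addr0; split=> //; case: h2.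
have hzk : c k.+1 z.
  have -> : z = x - y by rewrite exyz addrC addKr.
  by apply: submodB => //; apply: hsub.
have [_ hD _] := hck; rewrite exyz; apply: hD => //.
by have [] : (c k `&` N2) z by apply: hcap'.
Qed.

Definition len N1 N2 : nat := xget 0%N [set n | has_length N1 N2 n].

Lemma has_length_uniq N1 N2 n k : has_length N1 N2 n -> has_length N1 N2 k -> n = k.
Proof. by move=> [h1 h2] [h3 h4]; apply/eqP; rewrite eqn_leq h2 // h4. Qed.

Lemma lenP N1 N2 : finite_length N1 N2 -> has_length N1 N2 (len N1 N2).
Proof. exact: xgetPex. Qed.

Lemma lenE N1 N2 n : has_length N1 N2 n -> len N1 N2 = n.
Proof. by move=> h; exact: has_length_uniq (lenP (ex_intro _ n h)) h. Qed.

Lemma finite_length_bound N1 N2 b : is_submodule N1 -> N1 `<=` N2 ->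
  (forall k, has_chain N1 N2 k -> (k <= b)%N) -> finite_length N1 N2.
Proof.
move=> h1 h12 hb.
have [||n /asboolP hn hmax] := @ex_maxnP (fun k => `[< has_chain N1 N2 k >]) b.
- by exists 0%N; apply/asboolP; apply: has_chain0.
- by move=> k /asboolP/hb.
by exists n; split=> // k hk; apply/hmax/asboolP.
Qed.

Lemma finite_length_sub N1 N2 N1' N2' : is_submodule N1' -> N1' `<=` N2' ->
  N1 `<=` N1' -> N2' `<=` N2 -> finite_length N1 N2 -> finite_length N1' N2'.
Proof.
move=> h1' h12' h1 h2 [n [_ hn]]; apply: (@finite_length_bound _ _ n) => // k hk.
by apply: hn; apply: has_chain_sub hk.
Qed.

Lemma len_sub N1 N2 N1' N2' : is_submodule N1' -> N1' `<=` N2' ->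
  N1 `<=` N1' -> N2' `<=` N2 -> finite_length N1 N2 ->
  (len N1' N2' <= len N1 N2)%N.
Proof.
move=> h1' h12' h1 h2 hf; have [_] := lenP hf; apply.
apply: (has_chain_sub h1 h2).
by have [] := lenP (finite_length_sub h1' h12' h1 h2 hf).
Qed.

Lemma finite_length_trans N1 N2 N3 : is_submodule N1 -> is_submodule N2 ->
  is_submodule N3 -> N1 `<=` N2 -> N2 `<=` N3 ->
  finite_length N1 N2 -> finite_length N2 N3 -> finite_length N1 N3.
Proof.
move=> h1 h2 h3 h12 h23 [n [_ hn]] [k [_ hk]].
apply: (@finite_length_bound _ _ (n + k)) => //; first exact: subset_trans h23.
move=> l /(has_chain_split h1 h2 h3 h12 h23)[i [j [/hn hi /hk hj hl]]].
by apply: leq_trans hl _; apply: leq_add.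
Qed.

Lemma len_add N1 N2 N3 : is_submodule N1 -> is_submodule N2 ->
  is_submodule N3 -> N1 `<=` N2 -> N2 `<=` N3 -> finite_length N1 N3 ->
  len N1 N3 = (len N1 N2 + len N2 N3)%N.
Proof.
move=> h1 h2 h3 h12 h23 h13.
have f12 : finite_length N1 N2 by apply: finite_length_sub h13.
have f23 : finite_length N2 N3 by apply: finite_length_sub h13.
have [c12 m12] := lenP f12; have [c23 m23] := lenP f23.
apply: lenE; split; first exact: has_chain_cat c12 c23.
move=> l /(has_chain_split h1 h2 h3 h12 h23)[i [j [/m12 hi /m23 hj hl]]].
by apply: leq_trans hl _; apply: leq_add.
Qed.

Lemma len_eq0 N1 N2 : is_submodule N1 -> is_submodule N2 -> N1 `<=` N2 ->
  finite_length N1 N2 -> len N1 N2 = 0%N -> N1 = N2.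
Proof.
move=> h1 h2 h12 /lenP[_ hmax] h0; apply/seteqP; split=> //; apply: contrapT => h21.
have : (1 <= len N1 N2)%N; last by rewrite h0.
by apply: hmax; apply: has_chain_rcons (has_chain0 h1 (@subset_refl _ N1)).
Qed.

Lemma has_lengthxx N : is_submodule N -> has_length N N 0.
Proof.
move=> hN; split=> [|[//|k] [c [hc hS]]]; first exact: has_chain0.
have [_ hc0 _] := hc 0%N isT; have [_ _ hc1] := hc 1%N isT.
by have [_ []] := hS 0%N isT; apply: subset_trans hc0.
Qed.

End Length.

Section LengthIdeals.
Variable R : comPzRingType.
Implicit Types J K N P : set R.

(** Multiplication by [b] induces an isomorphism from [N / (N ∩ (P : b))] to [(N b + P) / P].
    Matching chains avoids quotient modules and makes [len_mulr] hold without a finiteness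
    hypothesis. *)
Lemma has_chain_mulr N P b k : is_ideal N -> is_ideal P ->
  @has_chain R R^o [set x | N x /\ P (x * b)] N k <->
  @has_chain R R^o P [set z | exists x u, [/\ N x, P u & z = x * b + u]] k.
Proof.
move=> hN hP; split=> [[c [hc hS]]|[c [hc hS]]].
  exists (fun i => [set z | exists x u, [/\ c i x, P u & z = x * b + u]]).
  split=> i hi.
    have [hci _ hciN] := hc i hi; split.
    - split.
      + by exists 0, 0; split; [exact: ideal0 hci|exact: ideal0 hP|rewrite mul0r addr0].
      + move=> _ _ [x [u [hx hu ->]]] [x' [u' [hx' hu' ->]]].
        exists (x + x'), (u + u'); split; [exact: idealD hci _ _|exact: idealD|].
        by rewrite mulrDl addrACA.
      + move=> r _ [x [u [hx hu ->]]]; exists (r * x), (r * u); split.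
        * exact: idealMl hci _.
        * exact: idealMl.
        * by rewrite -[LHS]/(r * _) mulrDr mulrA.
    - by move=> u hu; exists 0, u; split=> //; [exact: ideal0 hci|rewrite mul0r add0r].
    - by move=> _ [x [u [hx hu ->]]]; exists x, u; split=> //; apply: hciN.
  have [hsub hnsub] := hS i hi; have [hci hNc hciN] := hc i (ltnW hi).
  have [hci1 _ hci1N] := hc i.+1 hi.
  split; first by move=> _ [x [u [hx hu ->]]]; exists x, u; split=> //; apply: hsub.
  move=> hs; apply: hnsub => y hy.
  have [|x [u [hx hu e]]] := hs (y * b).
    by exists y, 0; split; [|exact: ideal0 hP|rewrite addr0].
  rewrite -(subrK x y); apply: (idealD hci) => //; apply: hNc; split.
    by apply: (idealB hN); [exact: hci1N|apply: hci1N; apply: hsub].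
  by rewrite mulrBl e addrC addKr.
exists (fun i => [set x | N x /\ c i (x * b)]); split=> i hi.
  have [hci hPc hcQ] := hc i hi; split.
  - split.
    + by split; [exact: ideal0|rewrite mul0r; exact: ideal0 hci].
    + move=> x y [hx hx'] [hy hy']; split; first exact: idealD.
      by rewrite mulrDl; apply: (idealD hci).
    + move=> r x [hx hx']; split; first exact: (@idealMl _ N r).
      by rewrite -[r *: x]/(r * x) -mulrA; apply: (idealMl _ hci).
  - by move=> x [hx hx']; split=> //; apply: hPc.
  - by move=> x [].
have [hsub hnsub] := hS i hi; have [hci hPc hciQ] := hc i (ltnW hi).
have [hci1 _ hci1Q] := hc i.+1 hi.
split; first by move=> x [hx hx']; split=> //; apply: hsub.
move=> hs; apply: hnsub => z hz; have [x [u [hx hu e]]] := hci1Q _ hz.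
rewrite e; apply: (idealD hci); last exact: hPc.
suff h : N x /\ c i.+1 (x * b) by have [_] := hs x h.
split=> //.
have -> : x * b = z - u by rewrite e addrK.
by apply: (idealB hci1) => //; apply/hsub/hPc.
Qed.

Lemma len_mulr N P b : is_ideal N -> is_ideal P ->
  @len R R^o [set x | N x /\ P (x * b)] N =
  @len R R^o P [set z | exists x u, [/\ N x, P u & z = x * b + u]].
Proof.
move=> hN hP; have h k := has_chain_mulr b k hN hP.
congr (xget _ _); apply/seteqP; split=> n [hn hmax]; split.
- exact/h.
- by move=> k /h/hmax.
- exact/h.
- by move=> k /h/hmax.
Qed.

(** The quotient is cyclic and killed by [m], so its length is at most one: an element [r * g + u]
    outside [N] has a unit [r], and any ideal above [N] containing it contains [g]. *)
Lemma finite_length_adjoin m N g : acc R -> local_ring m -> is_ideal N ->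
  (forall x, m x -> N (x * g)) -> @finite_length R R^o N (adjoin N g).
Proof.
move=> hA hm hN hg; have hNg := is_ideal_adjoin g hN.
apply: (@finite_length_bound R R^o _ _ 1) => //; first exact: adjoin_sub.
move=> [//|[//|k]] [c [hc hS]].
have [hc1 hN1 _] := hc 1%N isT; have [_ _ h2g] := hc 2%N isT.
have [_ hN0 _] := hc 0%N isT.
have [_ h21] := hS 1%N isT; have [_ h10] := hS 0%N isT.
exfalso; apply: h21; apply: subset_trans h2g _.
apply: adjoin_min => //; apply: contrapT => hcg; apply: h10.
apply: subset_trans hN0 => y hy.
have [_ _ h1g] := hc 1%N isT; have [r [u [hu e]]] := h1g _ hy.
rewrite e; apply: (idealD hN) => //; apply: hg; apply: contrapT => /(local_unit hA hm)[z hz].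
apply: hcg; rewrite -[g]mul1r -hz -mulrA; apply: (idealMl _ hc1).
have -> : r * g = y - u by rewrite e addrK.
by apply: (idealB hc1) => //; apply: hN1.
Qed.

Lemma finite_length_primary m K : acc R -> local_ring m -> is_ideal K ->
  (exists n, ideal_exp m n `<=` K) -> @finite_length R R^o K setT.
Proof.
move=> hA hm hK [n hn].
have hi k : is_ideal (ideal_exp m k) by apply: is_ideal_exp.
apply: (@finite_length_sub R R^o (ideal_exp m n) setT) => //.
elim: n {hn} => [|n IH].
  by exists 0%N; apply: has_lengthxx.
have hanti : ideal_exp m n.+1 `<=` ideal_exp m n by apply: ideal_exp_anti.
apply: (@finite_length_trans R R^o _ (ideal_exp m n) _ (hi _) (hi _) (is_idealT R)) => //.
have [s hs] := acc_noetherian hA (hi n).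
have hms g : g \in s -> forall x, m x -> ideal_exp m n.+1 (x * g).
  by move=> gs x hx; apply: ideal_expSM => //; rewrite hs; apply: sub_ideal_gen.
(* The generators of [m^n] are adjoined to [m^(n+1)] one at a time, each adding finite length. *)
suff [J [hJ h1J hsJ hfl]] : exists J, [/\ is_ideal J, ideal_exp m n.+1 `<=` J,
    [set` s] `<=` J & @finite_length R R^o (ideal_exp m n.+1) J].
  apply: finite_length_sub hfl => //; first exact: hi.
  by rewrite hs; apply: ideal_gen_sub.
elim: s {hs} hms => [|g s IHs] hms.
  exists (ideal_exp m n.+1); split=> //.
  by exists 0%N; apply: has_lengthxx; apply: hi.
have [|J [hJ h1J hsJ hfl]] := IHs; first by move=> g' hg'; apply: hms; rewrite inE hg' orbT.
exists (adjoin J g); split.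
- exact: is_ideal_adjoin.
- by apply: subset_trans h1J _; apply: adjoin_sub.
- move=> y /=; rewrite inE => /predU1P[->|hy]; first exact: adjoin_mem.
  by apply: adjoin_sub; apply: hsJ.
- have hJg := is_ideal_adjoin g hJ.
  apply: (@finite_length_trans R R^o _ J _ (hi _) hJ hJg) => //.
    exact: adjoin_sub.
  apply: (finite_length_adjoin hA hm hJ) => x hx; apply: h1J.
  by apply: hms => //; rewrite mem_head.
Qed.

End LengthIdeals.

(** * Hilbert functions *)

Section EventuallyPolynomial.
Implicit Types (f g : nat -> nat) (j n r : nat).

(* Integer-valued polynomials in n, written in the basis 'C(n + j, j). *)
Definition binb j n : nat := 'C(n + j, j).

(** The index counts coefficients, so it bounds the degree strictly; for a Hilbert function it
    bounds the dimension of the graded module, and [r = 0] means eventually zero. *)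
Definition evpoly r f : Prop := exists (c : nat -> int) (N : nat),
  forall n, (N <= n)%N -> (f n)%:Z = \sum_(j < r) c j * (binb j n)%:Z.

Lemma binb0 n : binb 0 n = 1%N. Proof. by rewrite /binb bin0. Qed.

Lemma binb_gt0 j n : (0 < binb j n)%N.
Proof. by rewrite bin_gt0 leq_addl. Qed.

Lemma binbS j n : binb j.+1 n.+1 = (binb j.+1 n + binb j n.+1)%N.
Proof. by rewrite /binb addSn binS !addnS addSn. Qed.

Lemma mul_binb j n : (j.+1 * binb j.+1 n = (n + j.+1) * binb j n)%N.
Proof. by rewrite /binb -mul_bin_diag addnS. Qed.

Lemma leq_binbS j n : (binb j n <= binb j.+1 n)%N.
Proof.
by rewrite -(leq_pmul2l (ltn0Sn j)) mul_binb leq_mul2r leq_addl orbT.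
Qed.

Lemma leq_binbl i j n : (i <= j)%N -> (binb i n <= binb j n)%N.
Proof.
move=> /subnK <-; elim: (j - i)%N => // k IH; rewrite addSn.
exact: leq_trans IH (leq_binbS _ _).
Qed.

Lemma leq_binbr j n k : (n <= k)%N -> (binb j n <= binb j k)%N.
Proof.
move=> /subnK <-; elim: (k - n)%N => // i IH; rewrite addSn.
apply: (leq_trans IH); case: j {IH} => [|j]; first by rewrite !binb0.
by rewrite binbS leq_addr.
Qed.

(** Rescaling the argument costs only a constant factor. This compares growth along powers of
    different ideals. *)
Lemma leq_binb_scale j q n : (binb j (q * n.+1) <= q.+1 ^ j * binb j n)%N.
Proof.
elim: j => [|j IH]; first by rewrite !binb0.
rewrite -(leq_pmul2l (ltn0Sn j)) mulnCA !mul_binb expnS -mulnA mulnCA.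
rewrite [X in (_ <= X)%N](_ : _ = (q.+1 * (n + j.+1)) * (q.+1 ^ j * binb j n))%N; last by ring.
by apply: leq_mul => //; nia.
Qed.

Lemma evpoly_eq r f g N : (forall n, (N <= n)%N -> f n = g n) ->
  evpoly r g -> evpoly r f.
Proof.
move=> h [c [N' hc]]; exists c, (maxn N N') => n; rewrite geq_max => /andP[h1 h2].
by rewrite h // hc.
Qed.

Lemma evpoly0 f : evpoly 0 f <-> exists N, forall n, (N <= n)%N -> f n = 0%N.
Proof.
split=> [[c [N h]]|[N h]].
  by exists N => n /h; rewrite big_ord0 => -[].
by exists (fun=> 0), N => n /h ->; rewrite big_ord0.
Qed.

Lemma evpoly_widen r s f : (r <= s)%N -> evpoly r f -> evpoly s f.
Proof.
move=> hrs [c [N hc]]; exists (fun j => if (j < r)%N then c j else 0), N => n hn.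
rewrite hc // [RHS](bigID (fun i : 'I_s => (i < r)%N)) /= [X in _ + X]big1 ?addr0.
  rewrite -(big_mkord xpredT (fun j => c j * (binb j n)%:Z)).
  rewrite (big_nat_widen _ _ _ _ _ hrs) big_mkord.
  by apply: eq_bigr => i /= ->.
by move=> i /negbTE ->; rewrite mul0r.
Qed.

Lemma evpoly_add r f g : evpoly r f -> evpoly r g -> evpoly r (fun n => f n + g n)%N.
Proof.
move=> [c [N hc]] [c' [N' hc']]; exists (fun j => c j + c' j), (maxn N N') => n.
rewrite geq_max => /andP[h1 h2]; rewrite PoszD hc // hc' // -big_split /=.
by apply: eq_bigr => i _; rewrite mulrDl.
Qed.

Lemma evpoly_sum r f g N : (forall n, (N <= n)%N -> f n.+1 = f n + g n.+1)%N ->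
  evpoly r g -> evpoly r.+1 f.
Proof.
move=> h [c [N' hc]]; pose M := maxn N N'.
pose p n := \sum_(j < r) c j * (binb j.+1 n)%:Z.
(* The constant coefficient makes both sides agree at [M]; [binbS] propagates the equality
   upwards. *)
exists (fun j => if j is i.+1 then c i else (f M)%:Z - p M), M => n hn.
rewrite big_ord_recl binb0 mulr1 -[X in _ + X]/(p n).
move: hn => /subnK <-; elim: (n - M)%N => [|k IH]; first by rewrite subrK.
have hM : (M <= k + M)%N by rewrite leq_addl.
have [hN hN'] : (N <= k + M /\ N' <= (k + M).+1)%N by move: hM; lia.
rewrite addSn h // PoszD IH -addrA; congr (_ + _).
rewrite hc // /p -big_split /=; apply: eq_bigr => i _.
by rewrite -mulrDr -PoszD -binbS.
Qed.

Lemma evpoly_diff r f g N : (forall n, (N <= n)%N -> f n.+1 = f n + g n.+1)%N ->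
  evpoly r.+1 f -> evpoly r g.
Proof.
move=> h [c [N' hc]]; exists (fun j => c j.+1), (maxn N N').+1 => -[//|n].
rewrite ltnS geq_max => /andP[h1 h2].
have -> : (g n.+1)%:Z = (f n.+1)%:Z - (f n)%:Z by rewrite h // PoszD addrAC subrr add0r.
rewrite !hc ?(leqW h2) // -sumrB big_ord_recl !binb0 subrr add0r.
apply: eq_bigr => i _; rewrite -mulrBr lift0 binbS PoszD.
by congr (_ * _); rewrite addrAC subrr add0r.
Qed.

Lemma evpoly_shift r f : evpoly r f -> evpoly r (fun n => f n.-1).
Proof.
move=> [c [N hc]].
(* By [binbS], [binb j.+1 n = binb j.+1 n.+1 - binb j n.+1], so each coefficient is also subtracted
   one index lower. *)
exists (fun j => c j - (if (j.+1 < r)%N then c j.+1 else 0)), N.+1 => -[//|n] hn /=.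
rewrite hc //; under [RHS]eq_bigr => i _ do rewrite mulrBl.
rewrite sumrB; apply/eqP; rewrite eq_sym subr_eq addrC -subr_eq -sumrB; apply/eqP.
case: r {hc} => [|r]; first by rewrite !big_ord0.
rewrite big_ord_recl !binb0 subrr add0r [RHS]big_ord_recr /= ltnn mul0r addr0.
apply: eq_bigr => i _; rewrite /bump /= add1n ltnS ltn_ord -mulrBr binbS PoszD.
by congr (_ * _); rewrite addrAC subrr add0r.
Qed.

Lemma abs_sum_binb (c : nat -> int) r n :
  (`|(\sum_(j < r.+1) c j * (binb j n)%:Z)%R| <=
   (\sum_(j < r.+1) `|c j|) * binb r n)%N.
Proof.
elim: r => [|r IH].
  by rewrite !big_ord_recl !big_ord0 !binb0 addr0 addn0 mulr1 muln1.
rewrite big_ord_recr [X in (_ <= X * _)%N]big_ord_recr /= mulnDl.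
apply: (@leq_trans (`|(\sum_(j < r.+1) c j * (binb j n)%:Z)%R| + `|c r.+1| * binb r.+1 n)%N).
  have -> : (`|c r.+1| * binb r.+1 n = `|(c r.+1 * (binb r.+1 n)%:Z)%R|)%N by rewrite abszM.
  by move: (\sum_(j < _) _) (c _ * _) => a b; lia.
rewrite leq_add2r; apply: (leq_trans IH); rewrite leq_mul2l leq_binbS; lia.
Qed.

Lemma evpoly_bound r f : evpoly r.+1 f -> exists C N, forall n, (N <= n)%N ->
  (f n <= C * binb r n)%N.
Proof.
move=> [c [N hc]]; exists (\sum_(j < r.+1) `|c j|)%N, N => n /hc h.
by rewrite -[f n]/(`|Posz (f n)|%N) h abs_sum_binb.
Qed.

Lemma evpoly_degree s r f C : evpoly s f ->
  (forall N, exists n, (N <= n)%N /\ (f n <= C * binb r n)%N) -> evpoly r.+1 f.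
Proof.
move=> hf hC; have [hsr|] := leqP s r.+1; first exact: evpoly_widen hf.
elim: s hf => // s IH [c [N hc]]; rewrite ltnS leq_eqVlt => hrs.
suff cs : c s = 0.
  have hs : evpoly s f.
    by exists c, N => n /hc ->; rewrite big_ord_recr /= cs mul0r addr0.
  by case/predU1P: hrs hs => [<-//|hrs] /IH; apply.
case: s hrs hc {IH} => // s hrs hc; apply/eqP; rewrite -absz_eq0 -leqn0 leqNgt.
apply/negP => cs_gt0; pose S := (\sum_(j < s.+1) `|c j|)%N.
(* For [n] this large, [mul_binb] makes [binb s.+1 n] exceed [(C + S) * binb s n], whereas a nonzero
   integer [c s.+1] forces the opposite inequality. *)
have [n [hn hfn]] := hC (maxn N (s.+1 * (C + S)))%N.
move: hn; rewrite geq_max => /andP[hN hnS].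
have h1 : (`|c s.+1| * binb s.+1 n <= (C + S) * binb s n)%N.
  have := hc n hN; rewrite big_ord_recr /= => e.
  have := abs_sum_binb c s n; rewrite -/S.
  have hB : (binb r n <= binb s n)%N by apply: leq_binbl; lia.
  have : (f n <= C * binb s n)%N by apply: (leq_trans hfn); rewrite leq_mul2l hB orbT.
  move: e; set T := \sum_(j < _) _; rewrite mulnDl.
  have -> : (`|c s.+1| * binb s.+1 n = `|(c s.+1 * (binb s.+1 n)%:Z)%R|)%N by rewrite abszM.
  lia.
have h2 : (binb s.+1 n <= (C + S) * binb s n)%N.
  by apply: leq_trans h1; rewrite leq_pmull.
have : (s.+1 * binb s.+1 n <= s.+1 * ((C + S) * binb s n))%N by rewrite leq_mul2l h2 orbT.
rewrite mul_binb mulnA leq_mul2r leqNgt; have := binb_gt0 s n; lia.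
Qed.

Lemma evpoly_le s r f g N : evpoly s f -> evpoly r g ->
  (forall n, (N <= n)%N -> (f n <= g n)%N) -> evpoly r f.
Proof.
move=> hf hg hfg; case: r hg => [|r] hg.
  apply/evpoly0; have /evpoly0[N' hN'] := hg; exists (maxn N N') => n.
  by rewrite geq_max => /andP[/hfg h1 /hN' h2]; apply/eqP; rewrite -leqn0 -h2.
have [C [N' hN']] := evpoly_bound hg; apply: (evpoly_degree (C := C) hf) => M.
exists (maxn M (maxn N N')); rewrite leq_maxl; split=> //.
by apply: (leq_trans (hfg _ _)); [|apply: hN']; rewrite !leq_max leqnn ?orbT.
Qed.

End EventuallyPolynomial.

(** * The Hilbert-Serre theorem and parameters of degree one *)

Section HilbertSerre.
Variables (A : comNzRingType) (I : set A).
Hypotheses (hI : is_ideal I) (hA : noetherian A).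
Implicit Types a b : nat -> set A.

Let hR : acc (rees I) := noetherian_rees hI hA.

Definition hilb a k : nat := @len A A^o (a k) (ideal_exp I k).

Definition finite_family a := forall k, @finite_length A A^o (a k) (ideal_exp I k).

Definition family_colon a (w : A) k : set A :=
  [set x | ideal_exp I k x /\ a k.+1 (x * w)].

(** In degree [k] the principal ideal of [w t] is [w I^(k-1)]; in degree 0 it is zero. *)
Definition pred_exp k : set A := if k is j.+1 then ideal_exp I j else [set 0].

Definition family_add a (w : A) k : set A :=
  [set z | exists x u, [/\ pred_exp k x, a k u & z = x * w + u]].

Lemma pred_exp_ideal k : is_ideal (pred_exp k).
Proof.
case: k => [|k]; last exact: is_ideal_exp.
by rewrite /= -ideal_gen_nil; apply: is_ideal_gen.
Qed.

Lemma family_colonP a w : rees_family I a -> I w ->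
  rees_family I (family_colon a w) /\ forall k, a k `<=` family_colon a w k.
Proof.
move=> [ha haI hM] hw; split; last first.
  by move=> k x hx; split; [apply: haI|rewrite mulrC; apply: hM].
split=> [k|k x []//|k x y hx [hy hyw]].
  split=> [|x y [hx hxw] [hy hyw]|r x [hx hxw]].
  - by split; [apply: ideal_exp0|rewrite mul0r; apply: ideal0].
  - by split; [apply: ideal_expD|rewrite mulrDl; apply: idealD].
  - split; first exact: ideal_expZ.
    by rewrite -[r *: x]/(r * x) -mulrA; apply: idealMl.
by split; [apply: ideal_expSM|rewrite -mulrA; apply: hM].
Qed.

Lemma family_addP a w : rees_family I a -> I w ->
  rees_family I (family_add a w) /\ forall k, a k `<=` family_add a w k.
Proof.
move=> [ha haI hM] hw; have hp := pred_exp_ideal; split; last first.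
  by move=> k u hu; exists 0, u; rewrite mul0r add0r; split=> //; apply: ideal0.
split=> [k|k _ [x [u [hx /haI hu ->]]]|k x _ hx [y [u [hy hu ->]]]].
- split.
  + by exists 0, 0; rewrite mul0r addr0; split=> //; apply: ideal0.
  + move=> _ _ [x [u [hx hu ->]]] [x' [u' [hx' hu' ->]]]; exists (x + x'), (u + u').
    by split; [apply: idealD|apply: idealD|rewrite mulrDl addrACA].
  + move=> r _ [x [u [hx hu ->]]]; exists (r * x), (r * u).
    by split; [apply: idealMl|apply: idealMl|rewrite -[LHS]/(r * _) mulrDr mulrA].
- apply: ideal_expD => //; case: k hx {hu} => [->|k hx]; first by rewrite mul0r.
  by rewrite mulrC; apply: ideal_expSM.
- exists (x * y), (x * u); split; [|exact: hM|by rewrite mulrDr mulrA].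
  case: k hy {hu} => [->|k hy]; first by rewrite mulr0; apply: ideal0.
  exact: ideal_expSM.
Qed.

Lemma finite_familyS a b : finite_family a -> rees_family I b ->
  (forall k, a k `<=` b k) -> finite_family b.
Proof.
move=> hF [hb hbI _] hab k; apply: finite_length_sub (hF k) => //; exact: hb.
Qed.

Lemma leq_hilb a b k : finite_family a -> rees_family I b ->
  (forall k, a k `<=` b k) -> (hilb b k <= hilb a k)%N.
Proof. by move=> hF [hb hbI _] hab; apply: len_sub (hF k) => //; apply: hb. Qed.

(** Additivity of length along the exact sequence [0 -> (S/(a : w t))(-1) -> S/a -> S/(a + (w t)) ->
    0], where [S] is the Rees algebra. *)
Lemma hilb_step a w k : rees_family I a -> finite_family a -> I w ->
  hilb a k.+1 = (hilb (family_colon a w) k + hilb (family_add a w) k.+1)%N.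
Proof.
move=> hfa hF hw; have [ha haI hM] := hfa.
have [[hb hbI _] hab] := family_addP hfa hw.
rewrite /hilb (@len_add A A^o _ (family_add a w k.+1)) //.
- by congr (_ + _)%N; rewrite -len_mulr //; apply: is_ideal_exp.
- exact: ha.
- exact: hb.
- exact: is_ideal_exp.
Qed.

Lemma hilb_eventually0 a : rees_family I a -> finite_family a -> I `<=` a 1%N ->
  exists N, forall n, (N <= n)%N -> hilb a n = 0%N.
Proof.
move=> hfa hF h1; have [ha haI _] := hfa; exists 1%N => -[//|k] _; rewrite /hilb.
have <- : a k.+1 = ideal_exp I k.+1; last exact: lenE (has_lengthxx (ha _)).
apply/seteqP; split; [exact: haI|apply: ideal_expS_sub => // x y /h1 hx hy].
by rewrite mulrC -addn1; apply: (rees_family_exp hfa).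
Qed.

(* Noetherian induction on [a], along multiplication by a generator [x] of [I]
   outside [a 1]: both a + (x) and, unless x is a nonzerodivisor, a : x are
   strictly larger. *)
Lemma hilbert_serre a (s : seq A) : rees_family I a -> finite_family a ->
  [set` s] `<=` I ->
  (forall x, I x -> exists y z, [/\ ideal_gen [set` s] y, a 1%N z & x = y + z]) ->
  evpoly (size s) (hilb a).
Proof.
move=> hfa; move: a hfa s.
apply: (rees_family_ind hR) => a hfa IH s hF; have [ha haI hM] := hfa.
elim: s => [|x s IHs] hsI hsa.
  apply/evpoly0; apply: hilb_eventually0 => // x /hsa[y [z [+ hz ->]]].
  by rewrite ideal_gen_nil => ->; rewrite add0r.
have hsI' : [set` s] `<=` I by move=> y ys; apply: hsI; rewrite /= inE ys orbT.
have hx : I x by apply: hsI; rewrite /= mem_head.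
have [hxa|hxa] := pselect (a 1%N x).
  apply: (evpoly_widen (leqnSn (size s))); apply: IHs => // y /hsa[y0 [z [+ hz ->]]].
  rewrite ideal_gen_cons => -[r [u [hu ->]]]; exists u, (r * x + z); split=> //.
    by apply: (idealD (ha _)) => //; apply: (idealMl _ (ha _)).
  by rewrite addrA [r * x + u]addrC.
have [hfb hab] := family_addP hfa hx; have [hfc hac] := family_colonP hfa hx.
have hb1 : family_add a x 1%N x.
  by exists 1, 0; rewrite mul1r addr0; split=> //; apply: ideal0.
have hb : evpoly (size s) (hilb (family_add a x)).
  apply: IH => //; [by exists 1%N => /(_ x hb1)|exact: finite_familyS hab|].
  move=> y /hsa[y0 [z [+ hz ->]]]; rewrite ideal_gen_cons => -[r [u [hu ->]]].
  exists u, (r * x + z); split=> //; last by rewrite addrA [r * x + u]addrC.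
  have [hbi _ _] := hfb; apply: (idealD (hbi _)); last exact: hab.
  exact: (idealMl _ (hbi _)).
have hstep n : hilb a n.+1 = (hilb (family_colon a x) n + hilb (family_add a x) n.+1)%N.
  exact: hilb_step.
have [hca|/existsNP[k hk]] := pselect (forall k, family_colon a x k `<=` a k).
  apply: (evpoly_sum (N := 0%N) _ hb) => n _; rewrite hstep; congr (_ + _)%N.
  by congr (len _ _); apply/seteqP; split.
have hc : evpoly (size (x :: s)) (hilb (family_colon a x)).
  apply: IH => //; [by exists k|exact: finite_familyS hac|].
  by move=> y /hsa[u [z [hu hz ->]]]; exists u, z; split=> //; apply: hac.
apply: (evpoly_eq (N := 1%N) _ (evpoly_add (evpoly_shift hc) (evpoly_widen (leqnSn _) hb))).
by move=> [|n].
Qed.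

Lemma hilb_evpoly a : rees_family I a -> finite_family a ->
  exists s, evpoly s (hilb a).
Proof.
move=> hfa hF; have [s hs] := hA hI; exists (size s); apply: hilbert_serre => //.
  by rewrite [X in _ `<=` X]hs; apply: sub_ideal_gen.
move=> x hx; exists x, 0; rewrite addr0; split=> //; first by rewrite -hs.
by have [ha _ _] := hfa; apply: ideal0.
Qed.

Section GoodElements.
Variable w : nat -> A.
Hypothesis hw : forall t, I (w t).
(** This form of general position stands in for avoiding finitely many associated primes and suits
    the Noetherian induction below; [generic_elements] provides it. *)
Hypothesis hwI : forall J, is_ideal J -> (forall N, exists t, (N <= t)%N /\ J (w t)) ->
  I `<=` J.

(* An element good for both a : w and a + (w), with w = w t0, is good for a.  Both
   families are larger than a unless w lies in a 1 or is a nonzerodivisor modulo a;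
   in the last case w itself is good. *)
Lemma good_elements a r : rees_family I a -> finite_family a ->
  evpoly r.+1 (hilb a) ->
  exists N, forall t, (N <= t)%N -> evpoly r (hilb (family_add a (w t))).
Proof.
move=> hfa; move: a hfa.
apply: (rees_family_ind hR) => a hfa IH hF hr; have [ha haI hM] := hfa.
have [h1|/existsNP[N0 /forallNP hN0]] := pselect (forall N, exists t, (N <= t)%N /\ a 1%N (w t)).
  exists 0%N => t _; apply: (evpoly_widen (leq0n r)); apply/evpoly0.
  have [hfb hab] := family_addP hfa (hw t).
  apply: hilb_eventually0 => //; first exact: finite_familyS hab.
  by apply: subset_trans (hab 1%N); apply: hwI.
have hnot t : (N0 <= t)%N -> ~ a 1%N (w t) by move=> ht hat; apply: (hN0 t).
have [hB|hB] := pselect (forall t, (N0 <= t)%N -> forall k, family_colon a (w t) k `<=` a k).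
  exists N0 => t ht; apply: (evpoly_diff (N := 0%N) _ hr) => n _.
  rewrite (hilb_step _ hfa hF (hw t)); congr (len _ _ + _)%N.
  by apply/seteqP; split; [apply: hB|apply: (family_colonP hfa (hw t)).2].
move/existsNP: hB => [t0 /not_implyP[ht0 /existsNP[k hk]]].
have [hfb hab] := family_colonP hfa (hw t0); set b := family_colon a (w t0) in hfb hab hk.
have [hfc hac] := family_addP hfa (hw t0); set c := family_add a (w t0) in hfc hac.
have hFb : finite_family b by apply: finite_familyS hab.
have hFc : finite_family c by apply: finite_familyS hac.
have [sb hsb] := hilb_evpoly hfb hFb; have [sc hsc] := hilb_evpoly hfc hFc.
have [||N1 hN1] := IH b hfb hab _ hFb.
- by exists k.
- by apply: (evpoly_le (N := 0%N) hsb hr) => n _; apply: leq_hilb.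
have [||N2 hN2] := IH c hfc hac _ hFc.
- exists 1%N => hca; apply: (hnot _ ht0); apply: hca; exists 1, 0.
  by rewrite mul1r addr0; split=> //; apply: ideal0.
- by apply: (evpoly_le (N := 0%N) hsc hr) => n _; apply: leq_hilb.
exists (maxn N1 N2) => t; rewrite geq_max => /andP[/hN1 hbt /hN2 hct].
have [hfd had] := family_addP hfa (hw t); set D := family_add a (w t) in hfd had *.
have hFd : finite_family D by apply: finite_familyS had.
have [sd hsd] := hilb_evpoly hfd hFd.
have [hfbt hbbt] := family_addP hfb (hw t); have [hfct hcct] := family_addP hfc (hw t).
(* Apply [hilb_step] for [w t0] to [D = a + (w t)]: as [D : w t0] contains [b + (w t)] and
   [D + (w t0)] contains [c + (w t)], both terms are bounded by the induction hypothesis. *)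
apply: (evpoly_le (N := 1%N) hsd (evpoly_add (evpoly_shift hbt) hct)) => -[//|n] _.
rewrite (hilb_step _ hfd hFd (hw t0)); apply: leq_add.
- have [hfe hde] := family_colonP hfd (hw t0).
  apply: leq_hilb => //; first exact: finite_familyS hbbt.
  have [_ hbtI _] := hfbt.
  move=> j z hz; split; first exact: hbtI hz.
  move: hz => [x [u [hx [hu hua] ->]]]; exists (x * w t0), (u * w t0); split=> //.
    case: j hx {hu hua} => [->|j hx]; first by rewrite mul0r; apply: ideal_exp0.
    by rewrite mulrC; apply: ideal_expSM.
  by rewrite mulrDl mulrAC.
- have [hfe hde] := family_addP hfd (hw t0).
  apply: leq_hilb => //; first exact: finite_familyS hcct.
  move=> j _ [x [_ [hx [x' [u [hx' hu ->]]] ->]]].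
  exists x', (x * w t + u); split=> //; first by exists x, u.
  by rewrite addrCA.
Qed.

(** Each good element lowers the dimension bound by one, so after [r] of them the quotient vanishes
    in large degrees. The clause over all [J] says that [I^(k+1)] lies in [a_(k+1) + ws I^k]. *)
Lemma parameters a r : rees_family I a -> finite_family a -> evpoly r (hilb a) ->
  exists ws : seq A, [/\ size ws = r, [set` ws] `<=` I &
    exists k, forall J, is_ideal J -> a k.+1 `<=` J ->
      (forall x v, ideal_exp I k x -> v \in ws -> J (x * v)) ->
      ideal_exp I k.+1 `<=` J].
Proof.
elim: r a => [|r IH] a hfa hF hr.
  exists [::]; split=> //; have /evpoly0[N hN] := hr; exists N => J hJ haJ _.
  have [ha haI _] := hfa; rewrite -(@len_eq0 A A^o (a N.+1) (ideal_exp I N.+1)) //.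
  - exact: ha.
  - exact: is_ideal_exp.
  - exact: hN.
have [N hN] := good_elements hfa hF hr.
have [hfb hab] := family_addP hfa (hw N).
have [|ws [hs hws [k hk]]] := IH _ hfb _ (hN N (leqnn _)).
  exact: finite_familyS hab.
exists (w N :: ws); split; first by rewrite /= hs.
  by move=> v /=; rewrite inE => /predU1P[->//|/hws].
exists k => J hJ haJ hJw; apply: hk => //.
  move=> _ [x [u [hx hu ->]]]; apply: idealD => //; last exact: haJ.
  by apply: hJw => //; rewrite mem_head.
by move=> x v hx hv; apply: hJw => //; rewrite inE hv orbT.
Qed.

End GoodElements.

End HilbertSerre.

(** * Generic elements over an infinite residue field *)

Section General.
Variables (A : comNzRingType) (m I : set A).
Hypotheses (hA : noetherian A) (hm : local_ring m) (hI : is_ideal I).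

Lemma vandermonde_mem (s : seq A) (t : nat -> A) (J : set A) : is_ideal J ->
  (forall i j, i != j -> ~ m (t i - t j)) ->
  (forall i, J (\sum_(k < size s) t i ^+ k * s`_k)) -> [set` s] `<=` J.
Proof.
move=> hJ ht hs; set r := size s in hs.
pose v : 'rV[A]_r := \row_j t j; pose x : 'rV[A]_r := \row_k s`_k.
pose V := Vandermonde r v.
have hV j : J ((x *m V) 0 j).
  rewrite mxE; move: (hs j); congr J; apply: eq_bigr => k _.
  by rewrite !mxE mulrC.
have hdet : exists y, y * \det V = 1.
  rewrite det_Vandermonde; apply: (big_ind (fun z => exists y, y * z = 1)).
  - by exists 1; rewrite mul1r.
  - by move=> y z [y' hy] [z' hz]; exists (y' * z'); rewrite mulrACA hy hz mulr1.
  move=> i _; apply: (big_ind (fun z => exists y, y * z = 1)).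
  - by exists 1; rewrite mul1r.
  - by move=> y z [y' hy] [z' hz]; exists (y' * z'); rewrite mulrACA hy hz mulr1.
  move=> j hij; apply: (local_unit (noetherian_acc hA) hm); rewrite !mxE.
  by apply: ht; rewrite gtn_eqF.
have [y hy] := hdet => z zs.
have hz : z = x 0 (Ordinal (etrans (index_mem z s) zs)) by rewrite mxE nth_index.
rewrite hz -[X in J X]mul1r -hy -mulrA; apply: idealMl => //.
have : (x *m V *m \adj V) = \det V *: x.
  by rewrite -mulmxA mul_mx_adj mul_mx_scalar.
move=> /matrixP/(_ 0 (Ordinal (etrans (index_mem z s) zs))).
rewrite [RHS]mxE => <-; rewrite mxE; apply: ideal_sum => // j _.
exact: idealMxr.
Qed.

Hypothesis hres : infinite_set (cosets m).

Lemma infinite_residues : exists t : nat -> A, forall i j, i != j -> ~ m (t i - t j).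
Proof.
have /infiniteP/ppcard_leP[f] := hres.
have /choice[t ht] : forall i, exists a, [set b | m (b - a)] = f i.
  move=> i; have [a _ ha] : cosets m (f i) by apply: (@funS _ _ _ _ f).
  by exists a.
exists t => i j /eqP hij hm'; apply: hij.
have [[hmi _ _] _] := hm.
suff e : f i = f j by apply: (@inj _ _ _ f) e; rewrite inE.
rewrite -!ht; apply/seteqP; split=> b /= hb.
  by rewrite -(subrK (t i) b) -addrA; apply: (idealD hmi).
have -> : b - t i = (b - t j) - (t i - t j) by ring.
exact: idealB.
Qed.

(** Points of the moment curve with parameters distinct modulo [m]: any [size s] of them generate
    [I], by [vandermonde_mem]. *)
Lemma generic_elements : exists w : nat -> A, (forall t, I (w t)) /\
  forall J, is_ideal J -> (forall N, exists t, (N <= t)%N /\ J (w t)) -> I `<=` J.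
Proof.
have [t ht] := infinite_residues; have [s hs] := hA hI.
have hsI k : I s`_k.
  have [hk|hk] := ltnP k (size s); last by rewrite nth_default //; apply: ideal0.
  by rewrite hs; apply: sub_ideal_gen; rewrite /= mem_nth.
exists (fun n => \sum_(k < size s) t n ^+ k * s`_k); split=> [n|J hJ hinf].
  by apply: ideal_sum => // k _; apply: idealMl.
have /choice[g hg] := hinf; pose n i := iter i (fun k => g k.+1) (g 0%N).
have hn i j : (i < j)%N -> (n i < n j)%N.
  move=> /subnK <-; elim: (j - i.+1)%N => [|k IH]; first exact: (hg _).1.
  by rewrite addSn; apply: (ltn_trans IH); apply: (hg _).1.
rewrite hs; apply: ideal_gen_sub => //.
apply: (@vandermonde_mem s (t \o n)) => // [i j hij|[|i]]; try exact: (hg _).2.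
apply: ht; move: hij; rewrite neq_ltn => /orP[]/hn; last by rewrite eq_sym => /ltn_eqF->.
by move=> /ltn_eqF->.
Qed.

End General.

(** * Hilbert coefficients and the Ratliff-Rush closure *)

Section HilbertSamuel.
Variables (A : comNzRingType) (m : set A) (d : nat).
Hypothesis hCM : CM_local_ring m d.
Implicit Types K J L : set A.

Let hN : noetherian A. Proof. by case: hCM. Qed.
Let hA : acc A := noetherian_acc hN.
Let hm : local_ring m. Proof. by case: hCM. Qed.
Let mid : is_ideal m. Proof. by have [[]] := hm. Qed.

Lemma primary_to_ideal K : primary_to m K -> is_ideal K.
Proof. by case=> [[]]. Qed.

Lemma maximal_power_exp K N k : ideal_exp m N `<=` K ->
  ideal_exp m (N * k) `<=` ideal_exp K k.
Proof. by move=> h; rewrite -ideal_exp_exp; apply: ideal_expS_mono. Qed.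

Lemma finite_length_exp K k : (exists N, ideal_exp m N `<=` K) ->
  @finite_length A A^o (ideal_exp K k) setT.
Proof.
move=> [N hNK]; apply: (finite_length_primary hA hm); first exact: is_ideal_exp.
by exists (N * k)%N; apply: maximal_power_exp.
Qed.

(** The ideal [K A[Kt]], with quotient [G(K)]; its Hilbert function is the first difference of
    [samuel K]. *)
Definition adic_family K k : set A := ideal_exp K k.+1.

Lemma adic_familyP K : rees_family K (adic_family K).
Proof.
split=> [k|k|k x y]; [exact: is_ideal_exp|exact: ideal_exp_anti|exact: ideal_expSM].
Qed.

Lemma finite_adic_family K : (exists N, ideal_exp m N `<=` K) ->
  finite_family K (adic_family K).
Proof.
move=> hK k; apply: finite_length_sub (finite_length_exp k.+1 hK) => //.
- exact: is_ideal_exp.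
- exact: ideal_exp_anti.
Qed.

Definition samuel K n : nat := @len A A^o (ideal_exp K n.+1) setT.

Lemma samuelS K n : (exists N, ideal_exp m N `<=` K) ->
  samuel K n.+1 = (samuel K n + hilb K (adic_family K) n.+1)%N.
Proof.
move=> hK; rewrite /samuel (@len_add A A^o _ (ideal_exp K n.+1)) //.
- by rewrite addnC.
- exact: is_ideal_exp.
- exact: is_ideal_exp.
- exact: ideal_exp_anti.
- exact: finite_length_exp.
Qed.

(** Hilbert-Serre bounds the degree only by the number of generators of [K]. The bound [d] comes
    from a parameter ideal [q] with [d] generators: as [q^p] lies in [K], [samuel K n] is at most
    [samuel q (p * n.+1)]. *)
Lemma samuel_evpoly K : primary_to m K -> evpoly d.+1 (samuel K).
Proof.
move=> hK; have hKi := primary_to_ideal hK.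
have [N1 hN1] := primary_to_exp hA mid hK.
have hKN : exists N, ideal_exp m N `<=` K by exists N1.
have [s hs] := hilb_evpoly hKi hN (adic_familyP K) (finite_adic_family hKN).
have hsK : evpoly s.+1 (samuel K).
  by apply: (evpoly_sum (N := 0%N) _ hs) => n _; apply: samuelS.
have [xs [_ hxm hxd hq]] := CM_parameter_ideal hCM.
set q := ideal_gen [set` xs] in hq.
have hqi : is_ideal q by apply: is_ideal_gen.
have hqm : q `<=` m by apply: ideal_gen_sub.
have hdq : evpoly d (hilb q (adic_family q)).
  rewrite -hxd; apply: (hilbert_serre hqi hN (adic_familyP q) (finite_adic_family hq)).
    exact: sub_ideal_gen.
  by move=> x hx; exists x, 0; rewrite addr0; split=> //; apply: (ideal_exp0 q 2).
have [C [N hC]] : exists C N, forall n, (N <= n)%N -> (samuel q n <= C * binb d n)%N.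
  apply: evpoly_bound; apply: (evpoly_sum (N := 0%N) _ hdq) => n _; exact: samuelS.
(* The successor keeps [p] positive, so that [p * n.+1] stays in the range of the bound for [q]. *)
pose p := N1.+1.
have hqp : ideal_exp q p `<=` K.
  apply: subset_trans hN1; apply: subset_trans (ideal_expS_mono hqm) _.
  exact: ideal_exp_anti.
apply: (evpoly_degree (C := (C * p.+1 ^ d)%N) hsK) => M.
exists (maxn M N); rewrite leq_maxl; split=> //; set n := maxn M N.
have hn : (N <= n)%N by rewrite leq_maxr.
apply: (@leq_trans (samuel q (p * n.+1)%N)); last first.
  apply: leq_trans (hC _ _) _; first by rewrite /p; nia.
  by rewrite -mulnA leq_mul2l leq_binb_scale orbT.
apply: len_sub => //; [exact: is_ideal_exp| |exact: finite_length_exp].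
apply: subset_trans (ideal_exp_anti (leqnSn _)) _.
by rewrite -ideal_exp_exp; apply: ideal_expS_mono.
Qed.

Lemma hilbert_sumE (e : nat -> int) n :
  \sum_(i < d.+1) (-1) ^+ i * e i * ('C(n + d - i, d - i))%:Z =
  \sum_(j < d.+1) ((-1) ^+ (d - j) * e (d - j)%N) * (binb j n)%:Z.
Proof.
rewrite (reindex_inj rev_ord_inj) /=; apply: eq_bigr => j _.
have hj : (j <= d)%N by rewrite -ltnS.
by rewrite subSS subKn // /binb -[(n + d - _)%N]addnBA ?leq_subr // subKn.
Qed.

Lemma hilbert_coeffs_ex K : primary_to m K -> exists e, hilbert_coeffs d K e.
Proof.
move=> hK; have [c [N hc]] := samuel_evpoly hK.
exists (fun i => (-1) ^+ i * c (d - i)%N); exists N => n hn.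
exists (samuel K n); split; first by apply/lenP/finite_length_exp/primary_to_exp.
rewrite hc // (hilbert_sumE (fun i => (-1) ^+ i * c (d - i)%N)); apply: eq_bigr => j _.
by rewrite mulrA -expr2 sqrr_sign mul1r subKn // -ltnS.
Qed.

Lemma hilbert_coeffs_bound K J e e' : (2 <= d)%N -> primary_to m K -> K `<=` J ->
  hilbert_coeffs d K e -> hilbert_coeffs d J e' -> (forall j, (j <= 1)%N -> e' j = e j) ->
  exists C N, forall n, (N <= n)%N ->
    (@len A A^o (ideal_exp K n.+1) (ideal_exp J n.+1) <= C * binb (d - 2) n)%N.
Proof.
move=> hd hK hKJ [N hKe] [N' hJe] hee.
pose c j := (-1) ^+ (d - j) * (e (d - j)%N - e' (d - j)%N).
exists (\sum_(j < (d - 2).+1) `|c j|)%N, (maxn N N') => n.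
rewrite geq_max => /andP[/hKe[l [/lenE hl el]] /hJe[l' [/lenE hl' el']]].
have e1 : (l = @len A A^o (ideal_exp K n.+1) (ideal_exp J n.+1) + l')%N.
  rewrite -hl -hl'; apply: len_add => //.
  - exact: is_ideal_exp.
  - exact: is_ideal_exp.
  - exact: ideal_expS_mono.
  - by apply/finite_length_exp/primary_to_exp.
have e2 : (@len A A^o (ideal_exp K n.+1) (ideal_exp J n.+1))%:Z =
    \sum_(j < (d - 2).+1) c j * (binb j n)%:Z.
  have -> : (@len A A^o (ideal_exp K n.+1) (ideal_exp J n.+1))%:Z = l%:Z - l'%:Z.
    by rewrite e1 PoszD addrK.
  rewrite el el' !hilbert_sumE -sumrB.
  rewrite -(big_mkord xpredT (fun j => c j * (binb j n)%:Z)).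
  rewrite -(big_mkord xpredT (fun j => (-1) ^+ (d - j) * e (d - j)%N * (binb j n)%:Z
     - (-1) ^+ (d - j) * e' (d - j)%N * (binb j n)%:Z)).
  (* The indices [d - 1] and [d], which carry [e 1] and [e 0], are split off and cancel. *)
  have {1}-> : d.+1 = (d - 2).+3 by lia.
  rewrite big_nat_recr //= big_nat_recr //=.
  rewrite [(d - (d - 2).+1)%N](_ : _ = 1%N); last by lia.
  rewrite [(d - (d - 2).+2)%N](_ : _ = 0%N); last by lia.
  rewrite (hee 0%N) // (hee 1%N) // !subrr !addr0 /c.
  by apply: eq_bigr => j _; rewrite mulrBr mulrBl.
by rewrite -[len _ _]/(`|Posz (len _ _)|)%N e2 abs_sum_binb.
Qed.

(** The colons [K^(k+1) : K^k] increase with [k], so one of them is the whole union. The chain [c]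
    starts at [K^2 : K] because the union starts at [k = 1]. *)
Lemma ratliff_rush_stable K : exists2 k, (0 < k)%N &
  ratliff_rush K = ideal_colon (ideal_exp K k.+1) (ideal_exp K k) /\
  forall j, (k <= j)%N -> forall x y, ratliff_rush K x -> ideal_exp K j y ->
    ideal_exp K j.+1 (x * y).
Proof.
pose c i := ideal_colon (ideal_exp K i.+2) (ideal_exp K i.+1).
have hc i : is_ideal (c i).
  split=> [y _|x x' hx hx' y hy|r x hx y hy].
  - by rewrite mul0r; apply: (ideal_exp0 K i.+2).
  - by rewrite mulrDl; apply: (ideal_expD (hx _ hy) (hx' _ hy)).
  - by rewrite -[r *: x]/(r * x) -mulrA; apply: (ideal_expZ _ (hx _ hy)).
have hcS i : c i `<=` c i.+1.
  move=> x hx; apply: (@ideal_expS_sub _ _ _ [set y | ideal_exp K i.+3 (x * y)]).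
    split=> [|u v hu hv|r u hu] /=.
    - by rewrite mulr0; apply: (ideal_exp0 K i.+3).
    - by rewrite mulrDr; apply: ideal_expD.
    - by rewrite -[r *: u]/(r * u) mulrCA; apply: ideal_expZ.
  by move=> u v hu hv /=; rewrite mulrCA; apply: ideal_expSM => //; apply: hx.
have [n hn] := hA hc hcS; have hmono := chain_mono hcS.
have e : ratliff_rush K = c n.
  apply/seteqP; split=> x; last by exists n.+1.
  move=> [[//|k] _ hx]; rewrite -(hn (maxn k n)) ?leq_maxr //.
  by apply: hmono hx; rewrite leq_maxl.
exists n.+1 => //; split=> // -[//|j] hj x y; rewrite e => hx hy.
by have := hmono n j hj x hx; apply.
Qed.

Lemma is_ideal_ratliff_rush K : is_ideal (ratliff_rush K).
Proof.
have [k _ [-> _]] := ratliff_rush_stable K.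
split=> [y _|x x' hx hx' y hy|r x hx y hy].
- by rewrite mul0r; apply: (ideal_exp0 K k.+1).
- by rewrite mulrDl; apply: (ideal_expD (hx _ hy) (hx' _ hy)).
- by rewrite -[r *: x]/(r * x) -mulrA; apply: (ideal_expZ _ (hx _ hy)).
Qed.

Lemma sub_ratliff_rush K : K `<=` ratliff_rush K.
Proof. by move=> x hx; exists 1%N => // y hy; apply: ideal_expSM. Qed.

Lemma regular_in_power K k : (0 < d)%N -> primary_to m K ->
  exists2 z, ideal_exp K k z & forall x, z * x = 0 -> x = 0.
Proof.
move=> hd hK; have [s [[_ hreg] hsm hsd _]] := CM_parameter_ideal hCM.
have hx x : s`_0 * x = 0 -> x = 0.
  move=> h; have := hreg 0%N; rewrite hsd take0 ideal_gen_nil => /(_ hd x); exact.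
have [p hp] : radical K s`_0.
  by have [_ ->] := hK; apply: hsm; rewrite /= mem_nth ?hsd.
exists ((s`_0 ^+ p) ^+ k); first exact: ideal_expX.
rewrite -exprM; elim: (p * k)%N => [|n IH] x; first by rewrite expr0 mul1r.
by rewrite exprS -mulrA => /hx/IH.
Qed.

(* Multiplying by a regular element z of K^k, with L K^k = K^(k+1), embeds the
   powers of L in those of K; hence they satisfy L^(n+1) = K L^n eventually. *)
Lemma ratliff_rush_exp K : (0 < d)%N -> primary_to m K ->
  exists N, forall n, (N <= n)%N -> ideal_exp (ratliff_rush K) n = ideal_exp K n.
Proof.
move=> hd hK; set L := ratliff_rush K.
have hKi := primary_to_ideal hK.
have hL : is_ideal L by apply: is_ideal_ratliff_rush.
have [k hk [_ hLK]] := ratliff_rush_stable K.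
have hLn n x y : ideal_exp L n x -> ideal_exp K k y -> ideal_exp K (n + k) (x * y).
  move=> hx hy; elim: n x hx => [|n IH] x; first by move=> _; apply: ideal_expZ.
  apply: (@ideal_expS_sub _ _ _ [set x | ideal_exp K (n.+1 + k) (x * y)]).
    split=> [|u v hu hv|r u hu] /=.
    - by rewrite mul0r; apply: ideal_exp0.
    - by rewrite mulrDl; apply: ideal_expD.
    - by rewrite -[r *: u]/(r * u) -mulrA; apply: ideal_expZ.
  move=> u v hu /IH hv /=; rewrite -mulrA addSn; apply: hLK => //.
  exact: leq_addl.
have [z hz hzreg] := regular_in_power k hd hK.
pose c n := [set z * x | x in ideal_exp L n].
have hzJ J : is_ideal J -> is_ideal [set z * x | x in J].
  move=> hJ; split=> [|_ _ [x hx <-] [y hy <-]|r _ [x hx <-]].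
  - by exists 0; [apply: ideal0|rewrite mulr0].
  - by exists (x + y); [apply: idealD|rewrite mulrDr].
  - by exists (r * x); [apply: idealMl|rewrite mulrCA].
have hc : rees_family K c.
  split=> [n|n _ [x hx <-]|n x _ hx [y hy <-]].
  - by apply: hzJ; apply: is_ideal_exp.
  - by rewrite mulrC; have := hLn _ _ _ hx hz; apply: ideal_exp_anti; apply: leq_addr.
  - exists (x * y); last by rewrite mulrCA.
    by apply: ideal_expSM => //; apply: sub_ratliff_rush.
have [n0 hn0] := rees_family_fg (noetherian_rees hKi hN) hc.
have hLS n J : (n0 <= n)%N -> is_ideal J ->
    (forall x y, K x -> ideal_exp L n y -> J (x * y)) -> ideal_exp L n.+1 `<=` J.
  move=> hn hJ hxy x hx; have [y hy e] : [set z * x | x in J] (z * x).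
  - apply: (hn0 n _ hn); [exact: hzJ| |by exists x].
    move=> u _ hu [v hv <-]; exists (u * v); last by rewrite mulrCA.
    exact: hxy.
  - suff -> : x = y by [].
    by apply/eqP; rewrite -subr_eq0; apply/eqP/hzreg; rewrite mulrBr e subrr.
have hLj j : forall J, is_ideal J ->
    (forall x y, ideal_exp K j x -> ideal_exp L n0 y -> J (x * y)) ->
    ideal_exp L (n0 + j) `<=` J.
  elim: j => [|j IH] J hJ h.
    by rewrite addn0 => y hy; rewrite -[y]mul1r; apply: h.
  rewrite addnS; apply: hLS => //; first exact: leq_addr.
  move=> x y hx; move: y; apply: (IH [set y | J (x * y)]).
    split=> [|u v hu hv|r u hu] /=.
    - by rewrite mulr0; apply: ideal0.
    - by rewrite mulrDr; apply: idealD.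
    - by rewrite -[r *: u]/(r * u) mulrCA; apply: idealMl.
  by move=> u v hu hv /=; rewrite mulrA; apply: h => //; apply: ideal_expSM.
(* [L^n] lies in [K^(n - n0) L^n0], and a factor [K^k] of [K^(n - n0)] carries [L^n0] into
   [K^(n0 + k)]. *)
exists (n0 + k)%N => n hn; apply/seteqP; split; last first.
  exact/ideal_expS_mono/sub_ratliff_rush.
have -> : n = (n0 + ((n - n0 - k) + k))%N by lia.
apply: hLj => [|x y + hy]; first exact: is_ideal_exp.
apply: (@ideal_expD_sub _ _ _ _ [set x | ideal_exp K (n0 + ((n - n0 - k) + k)) (x * y)]).
  split=> [|u v hu hv|r u hu] /=.
  - by rewrite mul0r; apply: ideal_exp0.
  - by rewrite mulrDl; apply: ideal_expD.
  - by rewrite -[r *: u]/(r * u) -mulrA; apply: ideal_expZ.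
move=> u v hu hv /=; rewrite -mulrA addnCA; apply: ideal_exp_mul => //.
by rewrite mulrC; apply: hLn.
Qed.

Lemma ratliff_rush_coeff_family K i : (0 < d)%N -> primary_to m K ->
  coeff_family m d i K (ratliff_rush K).
Proof.
move=> hd hK; have [N hNK] := ratliff_rush_exp hd hK.
have hL := is_ideal_ratliff_rush K; have [N1 hN1] := primary_to_exp hA mid hK.
split.
- apply: primary_to_local => //; last first.
    by exists N1; apply: subset_trans (@sub_ratliff_rush K).
  move=> h1; have [[hKi hK1 _] _] := hK; apply: hK1.
  apply: (@ideal_exp_sub _ K N.+1 hKi) => //.
  by rewrite -hNK // -(expr1n _ N.+1); apply: ideal_expX.
- exact: sub_ratliff_rush.
- have [e he] := hilbert_coeffs_ex hK; exists e, e; split=> //.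
  have [N2 hN2] := he; exists (maxn N N2) => n; rewrite geq_max => /andP[h1 h2].
  by rewrite hNK ?(leqW h1) //; apply: hN2.
Qed.

End HilbertSamuel.

(** * Torsion, complexes and iterated cones *)

Section Submodule.
Variables (R : pzRingType) (M : lmodType R) (S : set M).

Definition subm_pred (hS : is_submodule S) : {pred M} := fun x => `[< S x >].

Lemma subm_closed (hS : is_submodule S) : submod_closed (subm_pred hS).
Proof.
have [h0 hD hZ] := hS; split; first exact/asboolP.
by move=> a x y /asboolP hx /asboolP hy; apply/asboolP; apply: hD => //; apply: hZ.
Qed.

HB.instance Definition _ (hS : is_submodule S) :=
  GRing.isSubmodClosed.Build R M (subm_pred hS) (subm_closed hS).

Record subm (hS : is_submodule S) :=
  Subm { subm_val : M; _ : subm_val \in subm_pred hS }.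

HB.instance Definition _ (hS : is_submodule S) := [isSub of subm hS for @subm_val hS].
HB.instance Definition _ (hS : is_submodule S) := [Choice of subm hS by <:].
HB.instance Definition _ (hS : is_submodule S) :=
  [SubChoice_isSubLmodule of subm hS by <:].

End Submodule.

Section LinearMaps.
Variable R : pzRingType.

Definition is_lin (M N : lmodType R) (f : M -> N) : Prop :=
  (forall x y, f (x + y) = f x + f y) /\ (forall r x, f (r *: x) = r *: f x).

Variables (M N : lmodType R) (f : M -> N).
Hypothesis hf : is_lin f.

Lemma linD x y : f (x + y) = f x + f y. Proof. exact: hf.1. Qed.
Lemma linZ r x : f (r *: x) = r *: f x. Proof. exact: hf.2. Qed.
Lemma lin0 : f 0 = 0. Proof. by rewrite -(scale0r 0) linZ scale0r. Qed.
Lemma linN x : f (- x) = - f x. Proof. by rewrite -scaleN1r linZ scaleN1r. Qed.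
Lemma linB x y : f (x - y) = f x - f y. Proof. by rewrite linD linN. Qed.

End LinearMaps.

Lemma linear_is_lin (R : pzRingType) (M N : lmodType R) (f : {linear M -> N}) : is_lin f.
Proof. by split=> [x y|r x]; rewrite ?linearD ?linearZ. Qed.

(* Injectivity, as the extension of single-valued linear relations *)
Definition extends_relations (R : pzRingType) (Y : lmodType R) : Prop :=
  forall (N : lmodType R) (S : set (N * Y)%type), is_submodule S ->
    (forall y, S (0, y) -> y = 0) ->
    exists psi : N -> Y, is_lin psi /\ forall n y, S (n, y) -> psi n = y.

(** Single-valuedness makes the projection of [S] to [N] injective; the projection to [Y] is
    extended along it. *)
Lemma injective_extends (R : pzRingType) (Y : lmodType R) :
  injective_module Y -> extends_relations Y.
Proof.
move=> hY N S hS hS0.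
pose f : {linear subm hS -> N} := fst \o val; pose g : {linear subm hS -> Y} := snd \o val.
have hinj : injective f.
  move=> u v huv; apply: val_inj; apply/eqP; rewrite -subr_eq0; apply/eqP.
  have hv (x : subm hS) : S (val x) by have /asboolP := valP x.
  have := submodB hS (hv u) (hv v); have : (val u).1 = (val v).1 by [].
  case: (val u) (val v) => [u1 u2] [v1 v2] /= ->.
  rewrite -[(v1, u2) - (v1, v2)]/(v1 - v1, u2 - v2) subrr => /hS0 ->.
  by [].
have [h hh] := hY _ _ f g hinj; exists h; split; first exact: linear_is_lin.
move=> n y hny; have hin : (n, y) \in subm_pred hS by apply/asboolP.
exact: (hh (Subm hin)).
Qed.

Lemma extends_relations_prod (R : pzRingType) (Y Z : lmodType R) :
  extends_relations Y -> extends_relations Z -> extends_relations (Y * Z)%type.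
Proof.
move=> hY hZ N S [hS0 hSD hSZ] hS.
have [||psi [lpsi hpsi]] := hY N [set p | exists z, S (p.1, (p.2, z))].
- split=> [|[n y] [n' y'] [z hz] [z' hz']|r [n y] [z hz]] /=.
  + by exists 0.
  + by exists (z + z'); apply: (hSD _ _ hz hz').
  + by exists (r *: z); apply: (hSZ r _ hz).
- by move=> y [z /= /hS[]].
have [||phi [lphi hphi]] := hZ N [set p | exists y, S (p.1, (y, p.2))].
- split=> [|[n y] [n' y'] [z hz] [z' hz']|r [n y] [z hz]] /=.
  + by exists 0.
  + by exists (z + z'); apply: (hSD _ _ hz hz').
  + by exists (r *: z); apply: (hSZ r _ hz).
- by move=> z [y /= /hS[]].
exists (fun n => (psi n, phi n)); split.
  split=> [x y|r x]; first by rewrite (linD lpsi) (linD lphi).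
  by rewrite (linZ lpsi) (linZ lphi).
by move=> n [y z] h; congr pair; [apply: hpsi; exists z|apply: hphi; exists y].
Qed.

Section Torsion.
Variables (R : comPzRingType) (a : set R).
Hypotheses (hR : acc R) (ha : is_ideal a).
Implicit Types M Y : lmodType R.

Lemma power_mod M (N : set M) (x : M) : is_submodule N ->
  (forall g, a g -> exists p, N (g ^+ p *: x)) ->
  exists k, forall r, ideal_exp a k r -> N (r *: x).
Proof.
move=> [h0 hD hZ] h; have [s hs] := acc_noetherian hR ha.
have [k|_ r r' _ hr|g gs|k hk] := @graded_nilpotent _ s (fun=> [set r | N (r *: x)]).
- split=> [|r r' hr hr'|r r' hr] /=; first by rewrite scale0r.
    by rewrite scalerDl; apply: hD.
  by rewrite -scalerA; apply: hZ.
- by rewrite /= -scalerA; apply: hZ.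
- by apply: h; rewrite hs; apply: sub_ideal_gen.
- by exists k; rewrite {1}hs.
Qed.

Lemma is_submodule0 M : is_submodule [set 0 : M].
Proof. by split=> [//|x y -> ->|r x ->]; rewrite /= ?addr0 ?scaler0. Qed.

Lemma torsion_powers M (x : M) :
  (forall g, a g -> exists p, g ^+ p *: x = 0) -> torsion a M x.
Proof. by move=> h; apply: (power_mod (@is_submodule0 M)). Qed.

Lemma torsion_power M (x : M) g : torsion a M x -> a g -> exists p, g ^+ p *: x = 0.
Proof. by move=> [p hp] hg; exists p; apply: hp; apply: ideal_expX. Qed.

Lemma is_submodule_torsion M : is_submodule (torsion a M).
Proof.
split=> [|x y [p hp] [q hq]|r x [p hp]].
- by exists 0%N => r _; rewrite scaler0.
- exists (maxn p q) => r hr; rewrite scalerDr hp ?hq ?addr0 //.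
    by apply: ideal_exp_anti hr; rewrite leq_maxr.
  by apply: ideal_exp_anti hr; rewrite leq_maxl.
- by exists p => s hs; rewrite scalerA mulrC -scalerA hp // scaler0.
Qed.

Lemma torsion_lin M Y (f : M -> Y) x : is_lin f -> torsion a M x -> torsion a Y (f x).
Proof. by move=> hf [p hp]; exists p => r hr; rewrite -(linZ hf) hp // (lin0 hf). Qed.

(* [L] is maximal among submodules meeting the torsion trivially; every element
   then has a multiple by a power of each [g] in [a] lying in [L], so the
   projection to the torsion along [L], extended by injectivity, stays torsion. *)
Lemma torsion_retraction Y : extends_relations Y ->
  exists rho : Y -> Y, [/\ is_lin rho, forall x, torsion a Y (rho x) &
    forall x, torsion a Y x -> rho x = x].
Proof.
move=> hY; have [hT0 hTD hTZ] := is_submodule_torsion Y.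
(* [[set 0]] is added because Zorn's lemma also asks for the empty chain, whose union is empty. *)
pose P := [set L : set Y | is_submodule (L `|` [set 0]) /\
  forall x, L x -> torsion a Y x -> x = 0].
have [F hF hFt|L [[hL hLT] hmax]] := @Zorn_bigcup _ P.
  split; last by move=> x [L /hF[_ hL] hx]; apply: hL.
  split=> [|x y [[L hL hx]|->] [[L' hL' hy]|->]|r x [[L hL hx]|->]].
  - by right.
  - have [hLL|hLL] := hFt _ _ hL hL'.
      have [[_ hD _] _] := hF _ hL'.
      have [||h|/=->] := hD x y; [by left; apply: hLL|by left|by left; exists L'|by right].
    have [[_ hD _] _] := hF _ hL.
    have [||h|/=->] := hD x y; [by left|by left; apply: hLL|by left; exists L|by right].
  - by rewrite addr0; left; exists L.
  - by rewrite add0r; left; exists L'.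
  - by rewrite addr0; right.
  - have [[_ _ hZ] _] := hF _ hL.
    by have [|h|/=->] := hZ r x; [left|left; exists L|right].
  - by right; rewrite /= scaler0.
pose L0 := L `|` [set 0]; have [hL0 hLD hLZ] : is_submodule L0 by [].
have hL0T x : L0 x -> torsion a Y x -> x = 0 by move=> [/hLT|//].
have hsock y : ~ L0 y -> exists l r, [/\ L0 l, torsion a Y (l + r *: y) & l + r *: y <> 0].
  move=> hy; apply: contrapT => hn.
  pose L' := [set z | exists l r, L0 l /\ z = l + r *: y].
  have hLL' : L0 `<=` L' by move=> l hl; exists l, 0; rewrite scale0r addr0.
  apply: (hmax L'); split.
  - by move=> l hl; apply: hLL'; left.
  - move=> h; apply: hy; left; apply: h; exists 0, 1.
    by rewrite scale1r add0r.
  - have -> : L' `|` [set 0] = L' by apply/setUidPl => _ ->; apply: hLL'.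
    split=> [|_ _ [l [r [hl ->]]] [l' [r' [hl' ->]]]|s _ [l [r [hl ->]]]].
    + exact: hLL'.
    + exists (l + l'), (r + r'); split; first exact: hLD.
      by rewrite scalerDl addrACA.
    + exists (s *: l), (s * r); split; first exact: hLZ.
      by rewrite scalerDr scalerA.
  - move=> _ [l [r [hl ->]]] ht; apply: contrapT => h0; apply: hn.
    by exists l, r.
(* The ideals of all [r] with [r g^p x] in [L0] stabilise at some [p]. If [g^p x] were outside [L0],
   there would be a nonzero torsion element [l + r g^p x]; killing it by [g^k] gives [r] in
   [c (p + k) = c p], so it lies in [L0] and is zero. *)
have hpow x g : a g -> exists p, L0 (g ^+ p *: x).
  move=> hg; pose c p := [set r : R | L0 ((r * g ^+ p) *: x)].
  have hc p : is_ideal (c p).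
    split=> [|r s hr hs|s r hr] /=.
    - by rewrite /c /= mul0r scale0r.
    - by rewrite /c /= mulrDl scalerDl; apply: hLD.
    - by rewrite /c /= -[s *: r]/(s * r) -mulrA -scalerA; apply: hLZ.
  have [|p hp] := (hR : acc R) c hc.
    by move=> p r hr; rewrite /c /= exprSr mulrA mulrC -scalerA; apply: hLZ.
  exists p; apply: contrapT => /hsock[l [r [hl ht hne]]]; apply: hne.
  apply: (hL0T _ _ ht); have [k hk] := torsion_power ht hg.
  apply: hLD => //; rewrite scalerA; suff : c p r by [].
  rewrite -(hp (p + k)%N) ?leq_addr // /c /= exprD.
  have -> : (r * (g ^+ p * g ^+ k)) *: x = g ^+ k *: (l + r *: (g ^+ p *: x)) - g ^+ k *: l.
    by rewrite -scalerBr addrC addKr !scalerA; congr (_ *: _); ring.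
  by rewrite hk sub0r -scaleN1r scalerA; apply: hLZ.
pose S := [set p : Y * Y | torsion a Y p.2 /\ L0 (p.1 - p.2)].
have [||rho [lrho hrho]] := hY _ S.
- split=> [|[x u] [y v] [/= hu hx] [/= hv hy]|r [x u] [/= hu hx]].
  + by split; rewrite //= subr0.
  + split; first exact: hTD.
    by rewrite /= opprD addrACA; apply: hLD.
  + split; first exact: hTZ.
    by rewrite /= -scalerBr; apply: hLZ.
- move=> y [/= hy]; rewrite sub0r => /(hLZ (-1)); rewrite scaleN1r opprK => hy'.
  exact: hL0T.
exists rho; split=> // [x|x hx]; last by apply: hrho; split; rewrite //= subrr.
apply: torsion_powers => g /(hpow x)[p hp]; exists p.
by rewrite -(linZ lrho); apply: hrho; split; rewrite //= subr0.
Qed.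

End Torsion.

Section Complexes.
Variable R : comPzRingType.

Record cplx := Cplx {
  ob : nat -> lmodType R;
  df : forall n, ob n -> ob n.+1;
  df_lin : forall n, is_lin (@df n);
  df_df : forall n x, @df n.+1 (@df n x) = 0 }.

(* The term of degree n - 1: coboundaries of degree n, including n = 0, are the
   values of dpad. *)
Definition pad (X : cplx) n : lmodType R := if n is k.+1 then ob X k else 'rV[R]_0.

Definition dpad (X : cplx) n : pad X n -> ob X n :=
  match n with 0%N => fun=> 0 | k.+1 => @df X k end.

Lemma dpad_lin X n : is_lin (@dpad X n).
Proof.
case: n => [|n] /=; last exact: df_lin.
by split=> [x y|r x]; rewrite /= ?addr0 ?scaler0.
Qed.

Lemma df_dpad X n (x : pad X n) : df (dpad x) = 0.
Proof. by case: n x => [|n] x /=; [apply: lin0 (@df_lin X 0)|apply: df_df]. Qed.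

Lemma pad0_eq X (x y : pad X 0) : x = y.
Proof. by apply/rowP => -[]. Qed.

Section Cone.
Variables (w : R) (X : cplx).

Definition cone_df n (x : ob X n * pad X n) : ob X n.+1 * pad X n.+1 :=
  (df x.1, w *: x.1 - dpad x.2).

Lemma cone_df_lin n : @is_lin R (ob X n * pad X n)%type (ob X n.+1 * pad X n.+1)%type
  (@cone_df n).
Proof.
have h1 := @df_lin X n; have h2 := @dpad_lin X n; split=> [x y|r x].
  rewrite /cone_df /= (linD h1) (linD h2) scalerDr opprD; congr pair.
  by rewrite addrACA.
rewrite /cone_df /= (linZ h1) (linZ h2); congr pair.
by rewrite scalerBr !scalerA mulrC.
Qed.

Lemma cone_df_df n x : @cone_df n.+1 (@cone_df n x) = 0.
Proof.
have h1 := @df_lin X n; rewrite /cone_df /= df_df; congr pair.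
by rewrite (linB h1) (linZ h1) df_dpad subr0 subrr.
Qed.

(* The mapping cone of w on X, shifted; its iterates are Koszul complexes. *)
Definition cone : cplx := @Cplx (fun n => (ob X n * pad X n)%type) cone_df
  cone_df_lin cone_df_df.

End Cone.

Lemma cone_dpad w X n (u : ob X n) (v : pad X n) :
  @dpad (cone w X) n.+1 (u, v) = (df u, w *: u - dpad v).
Proof. by []. Qed.

Definition injective_cplx X := forall n, extends_relations (ob X n).

Lemma extends_relations_zero : extends_relations ('rV[R]_0 : lmodType R).
Proof.
move=> N S hS hS0; exists (fun=> 0); split; last by move=> n y _; apply/rowP => -[].
by split=> *; apply/rowP => -[].
Qed.

Lemma injective_cone w X : injective_cplx X -> injective_cplx (cone w X).
Proof.
move=> hX n; apply: extends_relations_prod; first exact: hX.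
by case: n => [|n]; [apply: extends_relations_zero|apply: hX].
Qed.

Variable a : set R.
Hypotheses (hR : acc R) (ha : is_ideal a).

(** The primitive [u] must be torsion as well: for an injective resolution this concerns the local
    cohomology modules in degrees up to [j]. *)
Definition kills_torsion_coh (r : R) j X := forall i, (i <= j)%N ->
  forall t : ob X i, torsion a _ t -> df t = 0 ->
  exists u : pad X i, torsion a _ u /\ r *: t = dpad u.

Lemma torsion_pair (M N : lmodType R) (x : M) (y : N) :
  torsion a M x -> torsion a N y -> torsion a (M * N)%type (x, y).
Proof.
move=> [p hp] [q hq]; exists (maxn p q) => r hr.
rewrite -[r *: (x, y)]/(r *: x, r *: y) hp ?hq //.
  by apply: ideal_exp_anti hr; rewrite leq_maxr.
by apply: ideal_exp_anti hr; rewrite leq_maxl.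
Qed.

Lemma torsion_fst (M N : lmodType R) (x : (M * N)%type) :
  torsion a (M * N)%type x -> torsion a M x.1.
Proof. by move=> [p hp]; exists p => r /hp; case: x {hp} => x y /= [->]. Qed.

Lemma torsion_snd (M N : lmodType R) (x : (M * N)%type) :
  torsion a (M * N)%type x -> torsion a N x.2.
Proof. by move=> [p hp]; exists p => r /hp; case: x {hp} => x y /= [_ ->]. Qed.

(** In the long exact sequence of the cone, degree [i] sits between degrees [i - 1] and [i] of [X],
    both killed by [r]. The exponent 2 does not depend on [w]. *)
Lemma kills_cone r j w X : kills_torsion_coh r j X ->
  kills_torsion_coh (r ^+ 2) j (cone w X).
Proof.
move=> hX i hi [x x'] ht [hx]; move/eqP; rewrite subr_eq0 => /eqP hx'.
have [/= tx tx'] := (torsion_fst ht, torsion_snd ht).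
have [u [tu hu]] := hX i hi x tx hx.
case: i hi x x' ht hx hx' tx tx' u tu hu => [|i] hi x x' ht hx hx' tx tx' u tu hu.
  exists 0; split; first by exists 0%N => s _; rewrite scaler0.
  rewrite /= -[LHS]/(r ^+ 2 *: x, r ^+ 2 *: x') expr2 -scalerA hu scaler0.
  by congr pair; apply: pad0_eq.
have [_ hTD hTZ] := @is_submodule_torsion R a (ob X i).
have h1 := @df_lin X i.
(* Once [r *: x] is the coboundary of [u], the defect [r *: x' - w *: u] is a torsion cocycle one
   degree lower. *)
have [||v [tv hv]] := hX i (ltnW hi) (r *: x' - w *: u).
- by apply: submodB; [exact: is_submodule_torsion|apply: hTZ|apply: hTZ].
- rewrite (linB h1) !(linZ h1) -[df x']hx' -[df u]hu !scalerA.
  by rewrite mulrC subrr.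
exists (r *: u, - v); split.
  apply: torsion_pair; first exact: hTZ.
  by rewrite -scaleN1r; have [_ _ hZ] := @is_submodule_torsion R a (pad X i); apply: hZ.
rewrite cone_dpad -[LHS]/(r ^+ 2 *: x, r ^+ 2 *: x') (linZ h1) -[df u]hu scalerA.
congr pair; rewrite (linN (@dpad_lin X i)) -hv scalerBr !scalerA opprK expr2.
by rewrite addrCA [w * r]mulrC subrr addr0.
Qed.

Definition nilpotent_coh (b : R) X := exists p, forall n (t : ob X n), df t = 0 ->
  exists u : pad X n, b ^+ p *: t = dpad u.

(** The map [(x, x') |-> (x', 0)] is a homotopy from multiplication by [w] to zero on the cone. *)
Lemma nilpotent_cone_self w X : nilpotent_coh w (cone w X).
Proof.
exists 1%N => n [x x'] [hx]; move/eqP; rewrite subr_eq0 => /eqP hx'; rewrite expr1.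
case: n x x' hx hx' => [|n] x x' hx hx'.
  exists 0; rewrite -[LHS]/(w *: x, w *: x') hx'.
  by congr pair; apply: pad0_eq.
exists (x', 0); rewrite cone_dpad -[LHS]/(w *: x, w *: x') hx'.
by rewrite (lin0 (@dpad_lin X n)) subr0.
Qed.

Lemma nilpotent_cone b w X : nilpotent_coh b X -> nilpotent_coh b (cone w X).
Proof.
move=> [p hp]; exists (p + p)%N => n [x x'] [hx].
move/eqP; rewrite subr_eq0 => /eqP hx'.
have [u hu] := hp n x hx.
case: n x x' hx hx' u hu => [|n] x x' hx hx' u hu.
  exists 0; rewrite -[LHS]/(b ^+ (p + p) *: x, b ^+ (p + p) *: x') exprD -scalerA hu scaler0.
  by congr pair; apply: pad0_eq.
have h1 := @df_lin X n.
have [|v hv] := hp n (b ^+ p *: x' - w *: u).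
  rewrite (linB h1) !(linZ h1) -[df x']hx' -[df u]hu !scalerA.
  by rewrite mulrC subrr.
exists (b ^+ p *: u, - v).
rewrite cone_dpad -[LHS]/(b ^+ (p + p) *: x, b ^+ (p + p) *: x') (linZ h1) -[df u]hu.
rewrite scalerA -exprD; congr pair.
rewrite (linN (@dpad_lin X n)) -hv scalerBr !scalerA opprK exprD.
by rewrite addrCA [w * _]mulrC subrr addr0.
Qed.

(* A homotopy h is built degree by degree so that id - dpad h maps cocycles
   to torsion; the torsion defect is removed by the retraction onto torsion. *)
Lemma torsion_representative X n (t : ob X n) : injective_cplx X ->
  (forall n (t : ob X n), df t = 0 -> forall g, a g ->
     exists p (u : pad X n), g ^+ p *: t = dpad u) ->
  df t = 0 -> exists u : pad X n, torsion a _ (t - dpad u).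
Proof.
move=> hX hcoh ht.
suff [h [lh hh]] : exists h : ob X n -> pad X n, is_lin h /\
    forall z, df z = 0 -> torsion a _ (z - dpad (h z)) by exists (h t); apply: hh.
elim: n {t ht} => [|n [h [lh hh]]].
  exists (fun=> 0); split; first by split=> *; rewrite ?addr0 ?scaler0.
  move=> z hz; rewrite subr0; apply: (torsion_powers hR ha) => g hg.
  by have [p [u hu]] := hcoh _ z hz g hg; exists p; rewrite hu.
have [rho [lrho hrhoT hrho]] := torsion_retraction hR ha (hX n).
pose e z := z - dpad (h z).
have le : is_lin e.
  split=> [x y|r x]; rewrite /e.
    by rewrite (linD lh) (linD (@dpad_lin X n)) opprD addrACA.
  by rewrite (linZ lh) (linZ (@dpad_lin X n)) scalerBr.
have h1 := @df_lin X n.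
(* [S] prescribes [k (df z) = e z - rho (e z)]. It is single-valued because [e] sends cocycles to
   torsion, where [rho] is the identity. *)
pose S := [set p : ob X n.+1 * ob X n | exists z, p.1 = df z /\ p.2 = e z - rho (e z)].
have [||k [lk hk]] := hX n _ S.
- split=> [|[x u] [y v] [z [/= -> ->]] [z' [/= -> ->]]|r [x u] [z [/= -> ->]]].
  + exists 0; rewrite (lin0 h1) (lin0 le) (lin0 lrho) subr0; by split.
  + exists (z + z'); rewrite (linD h1) (linD le) (linD lrho); split=> //=.
    by rewrite opprD addrACA.
  + exists (r *: z); rewrite (linZ h1) (linZ le) (linZ lrho); split=> //=.
    by rewrite scalerBr.
- move=> y [z [/= hz ->]]; rewrite hrho ?subrr //; exact: hh.
(* The difference is [df (rho (e u))]. For a cocycle [z] with [g ^+ p *: z = df u], it shows that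
   [g ^+ p *: (z - df (k z))] is torsion. *)
have tdk u : torsion a _ (df u - df (k (df u))).
  have -> : k (df u) = e u - rho (e u) by apply: hk; exists u.
  rewrite (linB h1) /e (linB h1) df_dpad subr0 opprB addrC subrK.
  exact: (torsion_lin h1).
exists k; split=> // z hz; have [hT0 hTD hTZ] := @is_submodule_torsion R a (ob X n.+1).
apply: (torsion_powers hR ha) => g hg.
have [p [u hu]] := hcoh _ z hz g hg.
have [q hq] := torsion_power (tdk u) hg; exists (q + p)%N.
have hu' : df u = g ^+ p *: z by [].
by rewrite exprD -scalerA scalerBr -(linZ h1) -(linZ lk) -hu'.
Qed.

End Complexes.

(** * Local cohomology and the annihilation of Koszul classes *)

Section Annihilator.
Variables (R : comPzRingType) (a : set R).
Hypotheses (hR : acc R) (ha : is_ideal a).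

(** Each element is killed by its own power of [g]. Uniformity comes from the submodules of all [z]
    with [g^k z] in [N1]: finite length makes one step an equality, and then all later ones. *)
Lemma finite_length_torsion_killed (M : lmodType R) (N1 N2 : set M) g :
  is_submodule N1 -> is_submodule N2 -> N1 `<=` N2 -> N2 `<=` torsion a M -> a g ->
  finite_length N1 N2 -> exists p, forall z, N2 z -> N1 (g ^+ p *: z).
Proof.
move=> h1 h2 h12 hT hg [n [_ hn]]; have [_ hD1 hZ1] := h1; have [h02 hD2 hZ2] := h2.
pose c k := [set z | N2 z /\ N1 (g ^+ k *: z)].
have hcS k : c k `<=` c k.+1.
  by move=> z [hz hgz]; split=> //; rewrite exprS -scalerA; apply: hZ1.
have [k [hk hck]] : exists k, (k < n.+1)%N /\ c k.+1 `<=` c k.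
  apply: contrapT => hno; have : (n.+1 <= n)%N; last by rewrite ltnn.
  apply: hn; exists c; split=> k hk; last first.
    by split=> // h; apply: hno; exists k.
  split.
  - split=> [|x y [hx hgx] [hy hgy]|r x [hx hgx]].
    + by split=> //; rewrite scaler0; case: h1.
    + by split; [apply: hD2|rewrite scalerDr; apply: hD1].
    + split; first exact: hZ2.
      by rewrite scalerA mulrC -scalerA; apply: hZ1.
  - by move=> z hz; split; [apply: h12|apply: hZ1].
  - by move=> z [].
have hcj j : c (j + k)%N `<=` c k.
  elim: j => // j IH z [hz hgz]; apply: hck; split=> //.
  have [|_] := IH (g *: z); last by rewrite scalerA -exprSr.
  by split; [apply: hZ2|rewrite scalerA -exprSr].
exists k => z hz; have [p hp] := torsion_power (hT _ hz) hg.
have [|//] := hcj p z; split=> //.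
by rewrite addnC exprD -scalerA hp scaler0; case: h1.
Qed.

Section Resolution.
Variables (M : lmodType R) (E : injective_resolution M).

Lemma ires_dif_dif n x : ires_dif E n.+1 (ires_dif E n x) = 0.
Proof. by apply/ires_exactS; exists x. Qed.

Definition res_cplx : cplx R :=
  Cplx (fun n => linear_is_lin (ires_dif E n)) ires_dif_dif.

Lemma injective_res_cplx : injective_cplx res_cplx.
Proof. by move=> n; apply/injective_extends/ires_injective. Qed.

Lemma res_kills d g : a g ->
  (forall i, (i < d)%N -> finite_length (lc_coboundaries a E i) (lc_cocycles a E i)) ->
  exists p, forall j, (j < d)%N -> kills_torsion_coh a (g ^+ p) j res_cplx.
Proof.
move=> hg hfl.
have hi i : (i < d)%N -> exists p, forall t : ob res_cplx i, torsion a _ t -> df t = 0 ->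
    exists u : pad res_cplx i, torsion a _ u /\ g ^+ p *: t = dpad u.
  move=> hid; have hT := @is_submodule_torsion R a.
  have hZ : is_submodule (lc_cocycles a E i).
    have [hT0 hTD hTZ] := hT (ires_obj E i).
    split=> [|x y [hx hdx] [hy hdy]|r x [hx hdx]]; rewrite /lc_cocycles /=.
    - by rewrite linear0.
    - by split; [apply: hTD|rewrite linearD hdx hdy addr0].
    - by split; [apply: hTZ|rewrite linearZ /= hdx scaler0].
  have [hB hBZ] : is_submodule (lc_coboundaries a E i) /\
      lc_coboundaries a E i `<=` lc_cocycles a E i.
    case: i {hid} hZ => [|i] hZ.
      by split; [apply: is_submodule0|move=> _ ->; case: hZ].
    have [hT0 hTD hTZ] := hT (ires_obj E i).
    split; last first.
      move=> _ [x hx <-]; split; last exact: ires_dif_dif.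
      exact: torsion_lin (linear_is_lin _) hx.
    split=> [|_ _ [x hx <-] [y hy <-]|r _ [x hx <-]].
    - by exists 0; rewrite ?linear0.
    - by exists (x + y); [apply: hTD|rewrite linearD].
    - by exists (r *: x); [apply: hTZ|rewrite linearZ].
  have [|p hp] := finite_length_torsion_killed hB hZ hBZ _ hg (hfl i hid).
    by move=> x [].
  exists p => t ht hdt; have := hp t (conj ht hdt).
  case: i {hid hZ hB hBZ hp} t ht hdt => [|i] t ht hdt /=.
    by move=> ->; exists 0; split=> //; have [] := hT 'rV[R]_0.
  by move=> [u hu <-]; exists u.
have /choice[p hp] : forall i, exists p, (i < d)%N ->
    forall t : ob res_cplx i, torsion a _ t -> df t = 0 ->
    exists u : pad res_cplx i, torsion a _ u /\ g ^+ p *: t = dpad u.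
  move=> i; have [/hi[p hp]|h] := boolP (i < d)%N; first by exists p.
  by exists 0%N.
exists (\max_(i < d) p i)%N => j hj i hij t ht hdt.
have hid : (i < d)%N by apply: leq_ltn_trans hj.
have [u [hu e]] := hp i hid t ht hdt.
have /subnK <- : (p i <= \max_(i < d) p i)%N by apply: (bigmax_sup (Ordinal hid)).
set q := (_ - _)%N; exists (g ^+ q *: u); split.
  by have [_ _ hZ] := @is_submodule_torsion R a (pad res_cplx i); apply: hZ.
by rewrite exprD -scalerA e (linZ (@dpad_lin _ _ i)).
Qed.

(* S is the image of the Koszul complex of M in that of its resolution; the
   relative exactness says that this inclusion is injective on cohomology. *)
Definition pad_set (X : cplx R) (S : forall n, set (ob X n)) n : set (pad X n) :=
  match n return set (pad X n) with 0%N => [set 0] | k.+1 => S k end.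

Definition relatively_exact (X : cplx R) (S : forall n, set (ob X n)) : Prop :=
  (forall n, is_submodule (S n)) /\
  forall n (v : ob X n), S n.+1 (df v) -> exists s (u : pad X n), S n s /\ v = s + dpad u.

Definition cone_set w (X : cplx R) (S : forall n, set (ob X n)) n : set (ob (cone w X) n) :=
  [set x | S n x.1 /\ @pad_set X S n x.2].

Lemma pad_set_submodule X (S : forall n, set (ob X n)) n :
  (forall n, is_submodule (S n)) -> is_submodule (@pad_set X S n).
Proof. by case: n => [|n] h /=; [apply: is_submodule0|apply: h]. Qed.

Lemma relatively_exact_cone w X S : @relatively_exact X S ->
  @relatively_exact (cone w X) (@cone_set w X S).
Proof.
move=> [hS hex]; have hP n := @pad_set_submodule X S n hS; split.
  move=> n; have [h0 hD hZ] := hS n; have [p0 pD pZ] := hP n.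
  split=> [//|[x x'] [y y'] [/= hx hx'] [/= hy hy']|r [x x'] [/= hx hx']].
    by split; [apply: hD|apply: pD].
  by split; [apply: hZ|apply: pZ].
move=> n [v v'] [/= hv hv']; have [s [u [hs e]]] := hex n v hv.
case: n v v' hv hv' s u hs e => [|n] v v' hv hv' s u hs e.
  exists (s, 0), 0; split; first by split.
  have -> : v = s by rewrite e /= addr0.
  by rewrite /= addr0; congr pair; apply: pad0_eq.
have [|s' [u' [hs' e']]] := hex n (w *: u - v').
  have h1 := @df_lin R X n.
  have -> : df (w *: u - v') = (w *: v - df v') - w *: s.
    have ewv : w *: v = w *: df u + w *: s by rewrite e scalerDr addrC.
    by rewrite ewv addrAC addrK (linB h1) (linZ h1).
  by have [_ _ hZ] := hS n.+1; apply: submodB => //; apply: hZ.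
exists (s, - s'), (u, u'); split.
  by split=> //=; rewrite -scaleN1r; have [_ _ hZ] := hS n; apply: hZ.
rewrite cone_dpad e; congr pair.
rewrite -[RHS]/(- s' + (w *: u - dpad u')).
by rewrite addrC -addrA -opprD [dpad u' + _]addrC -e' opprB addrCA subrr addr0.
Qed.

(* The cocycle alpha has component y along the top basis vector of the Koszul
   complex; that component of a coboundary lies in J M. *)
Definition leading (X : cplx R) (S : forall n, set (ob X n)) i (alpha : ob X i)
    (y : M) (J : set M) : Prop :=
  [/\ df alpha = 0, S i alpha, forall r, r *: y = 0 -> r *: alpha = 0 &
    exists pi : ob X i -> ires_obj E 0,
    [/\ is_lin pi, forall v, @pad_set X S i v -> exists g, J g /\ pi (dpad v) = ires_aug E g,
        forall x, S i x -> exists g, pi x = ires_aug E g &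
        pi alpha = ires_aug E y]].

Definition module_adjoin (J : set M) (w : R) : set M :=
  [set z | exists x u, J u /\ z = w *: x + u].

(** An element killing [y] kills [alpha], so [(alpha, 0)] is still a cocycle of degree 0, where the
    only coboundary is zero. *)
Lemma leading_cone_nil X S w (alpha : ob X 0) y : @leading X S 0 alpha y [set 0] ->
  w *: y = 0 ->
  @leading (cone w X) (@cone_set w X S) 0 (alpha, 0) y [set 0].
Proof.
move=> [hd hS hann [pi [lpi _ hpS hpy]]] hwy; split=> //.
- by rewrite /= /cone_df /= hd subr0 hann.
- by move=> r /hann h; rewrite -[LHS]/(r *: alpha, r *: (0 : pad X 0)) h scaler0.
exists (fun x => pi x.1); split=> //=.
- by split=> [x y'|r x]; [apply: (linD lpi)|apply: (linZ lpi)].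
- by move=> v _; exists 0; rewrite linear0 (lin0 lpi).
- by move=> x [/hpS].
Qed.

(** The degree rises by one and [y] moves to the new top component, in which coboundaries gain the
    multiples of [w]. *)
Lemma leading_cone X S i w (alpha : ob X i) y J : (forall n, is_submodule (S n)) ->
  is_submodule J -> @leading X S i alpha y J ->
  @leading (cone w X) (@cone_set w X S) i.+1 (0, alpha) y (module_adjoin J w).
Proof.
move=> hSs hJ [hd hS hann [pi [lpi hpd hpS hpy]]]; split.
- rewrite /= /cone_df /= (lin0 (@df_lin R X _)) scaler0 sub0r hd oppr0.
  by [].
- by split=> //=; case: (hSs i.+1).
- move=> r /hann h; rewrite -[LHS]/(r *: (0 : ob X i.+1), r *: alpha) h scaler0.
  by [].
exists (fun x => pi x.2); split=> //=.
- by split=> [x z|r x]; [apply: (linD lpi)|apply: (linZ lpi)].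
- move=> [u u'] [/= /hpS[x hx] /hpd[g [hg hgu]]]; exists (w *: x - g); split.
    exists x, (- g); split=> //.
    by rewrite -scaleN1r; have [_ _ hZ] := hJ; apply: hZ.
  by rewrite (linB lpi) (linZ lpi) hx hgu linearB linearZ.
- by move=> x [_ /hpS].
Qed.

End Resolution.

Definition cones (l : seq R) (X : cplx R) : cplx R := foldr (@cone R) X l.

Lemma kills_cones l r j X : kills_torsion_coh a r j X ->
  kills_torsion_coh a (r ^+ (2 ^ size l)) j (cones l X).
Proof.
move=> h; elim: l => [|w l IH]; first by rewrite expr1.
by rewrite /= expnS mulnC exprM; apply: kills_cone.
Qed.

Lemma injective_cones l X : injective_cplx X -> injective_cplx (cones l X).
Proof. by move=> h; elim: l => //= w l IH; apply: injective_cone. Qed.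

Lemma nilpotent_cones l b X : b \in l -> nilpotent_coh b (cones l X).
Proof.
elim: l => //= w l IH; rewrite inE => /predU1P[->|/IH h]; first exact: nilpotent_cone_self.
exact: nilpotent_cone.
Qed.

Fixpoint cones_set (l : seq R) (X : cplx R) (S : forall n, set (ob X n)) :
    forall n, set (ob (cones l X) n) :=
  if l is w :: l' return forall n, set (ob (cones l X) n)
  then @cone_set w (cones l' X) (@cones_set l' X S) else S.

Lemma relatively_exact_cones l X S : @relatively_exact X S ->
  @relatively_exact (cones l X) (@cones_set l X S).
Proof. by move=> h; elim: l => //= w l IH; apply: relatively_exact_cone. Qed.

Section Regular.
Variable E : injective_resolution (R^o : lmodType R).

Definition aug_set n : set (ob (res_cplx E) n) :=
  match n with 0%N => [set x | exists y, ires_aug E y = x] | k.+1 => [set 0] end.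

Lemma relatively_exact_res : @relatively_exact (res_cplx E) aug_set.
Proof.
split=> [[|n]|[|n] v hv]; last 2 first.
- have [y hy] : exists y, ires_aug E y = v by apply/ires_exact0.
  by exists v, 0; split; [exists y|rewrite /= addr0].
- have [u hu] : exists u, ires_dif E n u = v by apply/ires_exactS.
  by exists 0, u; rewrite add0r; split.
- split=> [|_ _ [y <-] [y' <-]|r _ [y <-]]; first by exists 0; rewrite linear0.
    by exists (y + y'); rewrite linearD.
  by exists (r *: y); rewrite linearZ.
- exact: is_submodule0.
Qed.

Lemma leading_zeros (zs : seq R) (y : R^o) : (forall z, z \in zs -> z * y = 0) ->
  exists alpha, @leading _ E (cones zs (res_cplx E)) (@cones_set zs _ aug_set) 0
    alpha y [set 0].
Proof.
elim: zs => [|z zs IH] hz.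
  exists (ires_aug E y); split.
  - by apply/ires_exact0; exists y.
  - by exists y.
  - by move=> r hr; rewrite -linearZ hr linear0.
  - exists id; split=> //; last by move=> x [u <-]; exists u.
    by move=> v _; exists 0; rewrite linear0.
have [|alpha halpha] := IH; first by move=> x hx; apply: hz; rewrite inE hx orbT.
exists (alpha, 0); apply: leading_cone_nil => //.
by apply: hz; rewrite mem_head.
Qed.

(** [foldr] puts [zs] innermost: they are adjoined while the degree is 0 and contribute nothing to
    the ideal; each element of [ws] then raises the degree. *)
Lemma leading_cones (ws zs : seq R) (y : R^o) : (forall z, z \in zs -> z * y = 0) ->
  exists alpha, @leading _ E (cones (ws ++ zs) (res_cplx E))
    (@cones_set (ws ++ zs) _ aug_set) (size ws) alpha y (ideal_gen [set` ws]).
Proof.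
move=> hz; elim: ws => [|w ws [alpha halpha]].
  by rewrite ideal_gen_nil; apply: leading_zeros.
exists (0, alpha); have -> : ideal_gen [set` w :: ws] =
    @module_adjoin R^o (ideal_gen [set` ws]) w.
  rewrite ideal_gen_cons; apply/seteqP; split=> _ [r [u [hu ->]]]; exists r, u;
    by rewrite -?[w *: r]/(w * r) [r * w]mulrC.
apply: leading_cone => //; last exact: is_ideal_gen.
exact: (relatively_exact_cones (ws ++ zs) relatively_exact_res).1.
Qed.

(** The exponent is fixed before [ws]: beyond [p0] it only needs a factor 2 for each cone. This
    uniformity allows [ws] to consist of arbitrarily high powers. *)
Lemma koszul_annihilator d (zs : seq R) (y g : R) : (0 < d)%N -> a g ->
  (forall i, (i < d)%N -> finite_length (lc_coboundaries a E i) (lc_cocycles a E i)) ->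
  (forall z, z \in zs -> z * y = 0) ->
  exists p, forall ws : seq R, size ws = d.-1 ->
    (forall h, a h -> exists N, ideal_gen [set` ws ++ zs] (h ^+ N)) ->
    ideal_gen [set` ws] (g ^+ p * y).
Proof.
move=> hd hg hfl hz; have [p0 hp0] := res_kills hg hfl.
exists (p0 * 2 ^ (d.-1 + size zs))%N => ws hws hrad.
set p := (p0 * _)%N; set l := ws ++ zs; pose X := cones l (res_cplx E).
have hd1 : (size ws < d)%N by rewrite hws prednK.
have hkill : kills_torsion_coh a (g ^+ p) (size ws) X.
  rewrite /p -hws -size_cat exprM; apply: kills_cones; exact: hp0.
have [alpha [halpha hS _ [pi [lpi hpd _ hpy]]]] := leading_cones ws hz.
have hcoh n (t : ob X n) : df t = 0 -> forall h, a h ->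
    exists N (u : pad X n), h ^+ N *: t = dpad u.
  move=> ht h /hrad[N hN]; pose B := [set r : R | exists u : pad X n, r *: t = dpad u].
  have lD := @dpad_lin _ X n.
  have [k|_ r r' _ [u hu]|b bl|k hk] := @graded_nilpotent _ l (fun=> B).
  - split=> [|r r' [u hu] [u' hu']|r r' [u hu]].
    + by exists 0; rewrite scale0r (lin0 lD).
    + by exists (u + u'); rewrite scalerDl hu hu' (linD lD).
    + by exists (r *: u); rewrite (linZ lD) -hu scalerA.
  - by exists (r *: u); rewrite (linZ lD) -hu scalerA.
  - by have [q hq] := nilpotent_cones (res_cplx E) bl; exists q; apply: hq.
  - exists (N * k)%N; rewrite exprM; apply: hk.
    exact: ideal_expX.
have [u hu] := torsion_representative hR ha (injective_cones (l := l) (@injective_res_cplx _ E))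
  hcoh halpha.
have lD := @dpad_lin _ X (size ws); have lF := @df_lin _ X (size ws).
have [|u' [_ hu']] := hkill _ (leqnn _) _ hu.
  by rewrite (linB lF) halpha df_dpad subr0.
have [hSs hex] := relatively_exact_cones l relatively_exact_res.
have hv : g ^+ p *: alpha = dpad (g ^+ p *: u + u').
  by rewrite (linD lD) (linZ lD) -hu' scalerBr addrC subrK.
(* Relative exactness exchanges the primitive in the injective terms for one coming from the Koszul
   complex of the ring, to which [hpd] applies. *)
have [s [hs hsv]] : exists s, @pad_set X (@cones_set l _ aug_set) (size ws) s /\
    g ^+ p *: alpha = dpad s.
  have : @cones_set l _ aug_set (size ws) (g ^+ p *: alpha).
    by have [_ _ hZ] := hSs (size ws); apply: hZ.
  move: (g ^+ p *: u + u') hv => v ->.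
  move: (size ws) v => [|n] v; first by exists 0; split=> //; congr dpad; apply: pad0_eq.
  by move=> /hex[s [x [hs ->]]]; exists s; split=> //; rewrite (linD (@dpad_lin _ X n.+1)) /= df_dpad addr0.
have [y' [hy' e]] := hpd _ hs.
rewrite -[g ^+ p * y]/(g ^+ p *: (y : R^o)).
suff -> : g ^+ p *: (y : R^o) = y' by [].
by apply: (ires_aug_inj (i := E)); rewrite linearZ -hpy -e -hsv (linZ lpi).
Qed.

End Regular.

End Annihilator.

(** * The associated graded ring *)

Section AssociatedGraded.
Variables (A : comNzRingType) (I : set A).
Hypothesis hI : is_ideal I.

Definition gr_monom k (a : A) : gr I := \pi_(gr I) (rees_monom I k a).

Lemma rees_monomD k a b : ideal_exp I k a -> ideal_exp I k b ->
  rees_monom I k (a + b) = rees_monom I k a + rees_monom I k b.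
Proof.
move=> ha hb; apply: val_inj; rewrite raddfD /= !val_rees_monom //.
  by rewrite scalerDl.
exact: ideal_expD.
Qed.

Lemma rees_monomM i j a b : ideal_exp I i a -> ideal_exp I j b ->
  rees_monom I (i + j) (a * b) = rees_monom I i a * rees_monom I j b.
Proof.
move=> ha hb; apply: val_inj; rewrite rmorphM /= !val_rees_monom //.
  by rewrite -scalerAl -scalerAr scalerA -exprD.
exact: ideal_exp_mul.
Qed.

Lemma gr_monomD k a b : ideal_exp I k a -> ideal_exp I k b ->
  gr_monom k (a + b) = gr_monom k a + gr_monom k b.
Proof. by move=> ha hb; rewrite /gr_monom rees_monomD // raddfD. Qed.

Lemma gr_monomM i j a b : ideal_exp I i a -> ideal_exp I j b ->
  gr_monom i a * gr_monom j b = gr_monom (i + j) (a * b).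
Proof. by move=> ha hb; rewrite /gr_monom rees_monomM // pi_gr_mul. Qed.

Lemma gr_monomX a n : I a -> gr_monom 1 a ^+ n = gr_monom n (a ^+ n).
Proof.
move=> ha; have ha1 : ideal_exp I 1 a by rewrite ideal_exp1.
elim: n => [|n IH]; last first.
  by rewrite !exprS IH gr_monomM // ?add1n //; apply: ideal_expX.
rewrite !expr0 /gr_monom.
have -> : rees_monom I 0 1 = 1.
  by apply: val_inj; rewrite val_rees_monom // scale1r expr0 rmorph1.
by rewrite -[1]/(gr_one I) piE.
Qed.

Lemma pi_grP (p q : rees I) : \pi_(gr I) p = \pi_(gr I) q <->
  forall i, ideal_exp I i.+1 ((val p)`_i - (val q)`_i).
Proof.
have e : (\pi_(gr I) p == \pi_(gr I) q) = (p - q \in gr_ideal I).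
  by rewrite piE Quotient.equivE.
split=> [/eqP|h]; last first.
  by apply/eqP; rewrite e; apply/gr_idealP => i; rewrite raddfB coefB.
by rewrite e => /gr_idealP h i; have := h i; rewrite raddfB coefB.
Qed.

Lemma gr_monom_eq0 k a : ideal_exp I k.+1 a -> gr_monom k a = 0.
Proof.
move=> ha; have ha' : ideal_exp I k a by apply: ideal_exp_anti ha.
have -> : (0 : gr I) = \pi_(gr I) 0 by rewrite raddf0.
apply/pi_grP => i; rewrite val_rees_monom // raddf0 coef0 subr0 coefZ coefXn.
by case: eqP => [->|_]; rewrite ?mulr1 // mulr0; apply: ideal_exp0.
Qed.

Lemma gr_monom_ideal (D : set (gr I)) k : is_ideal D ->
  is_ideal [set c | ideal_exp I k c /\ D (gr_monom k c)].
Proof.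
move=> hD; split=> [|c c' [hc hDc] [hc' hDc']|r c [hc hDc]] /=.
- split; first exact: ideal_exp0.
  by rewrite gr_monom_eq0; [apply: ideal0|apply: ideal_exp0].
- by split; [apply: ideal_expD|rewrite gr_monomD //; apply: idealD].
- split; first exact: ideal_expZ.
  by rewrite -[r *: c]/(r * c) -[k]add0n -gr_monomM //; apply: idealMl.
Qed.

Lemma is_ideal_gr_plus : is_ideal (@gr_plus A I).
Proof.
split=> [|_ _ [p hp <-] [q hq <-]|r _ [p hp <-]].
- by exists 0; [rewrite /= ?raddf0 coef0|rewrite raddf0].
- exists (p + q); last by rewrite raddfD.
  by rewrite /= ?raddfD coefD hp hq addr0.
- exists (repr r * p); last by rewrite pi_gr_mul reprK.
  by rewrite /= ?rmorphM coefM big_ord_recl big_ord0 subnn hp mulr0 addr0.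
Qed.

Lemma gr_plus_monom a : I a -> gr_plus I (gr_monom 1 a).
Proof.
move=> ha; exists (rees_monom I 1 a) => //=.
by rewrite val_rees_monom ?ideal_exp1 // coefZ coefXn mulr0.
Qed.

Lemma gr_plus_gen (xs : seq A) : I = ideal_gen [set` xs] ->
  @gr_plus A I `<=` ideal_gen [set` [seq gr_monom 1 x | x <- xs]].
Proof.
set D := ideal_gen [set` [seq _ | _ <- _]] => hxs.
have hD : is_ideal D by apply: is_ideal_gen.
have h1 : I `<=` [set c | ideal_exp I 1 c /\ D (gr_monom 1 c)].
  rewrite [X in X `<=` _]hxs; apply: ideal_gen_sub; first exact: gr_monom_ideal.
  move=> x xs_x; split; first by rewrite ideal_exp1 // hxs; apply: sub_ideal_gen.
  by apply: sub_ideal_gen; apply: map_f.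
have hk k : ideal_exp I k.+1 `<=` [set c | ideal_exp I k.+1 c /\ D (gr_monom k.+1 c)].
  apply: ideal_expS_sub; first exact: gr_monom_ideal.
  move=> u v hu hv; have [hu1 hDu] := h1 _ hu; split; first exact: ideal_expSM.
  by rewrite -[k.+1]add1n -gr_monomM //; apply: (idealMxr _ hD).
move=> _ [p hp0 <-]; rewrite -[p]rees_sum raddf_sum; apply: (ideal_sum _ hD) => -[[|i] hi] _ /=.
  rewrite hp0 -/(gr_monom 0 0) gr_monom_eq0; first exact: ideal0.
  exact: ideal_exp0.
by have [] := hk i _ (rees_coef p i.+1).
Qed.

(** The classes of polynomials without terms below degree [M] form an ideal containing [s]. This
    turns membership in an ideal generated by high powers into vanishing. *)
Lemma gr_monom_low_degree (s : seq (gr I)) M k c : (k < M)%N -> ideal_exp I k c ->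
  (forall x, x \in s -> exists2 a, ideal_exp I M a & x = gr_monom M a) ->
  ideal_gen [set` s] (gr_monom k c) -> ideal_exp I k.+1 c.
Proof.
move=> hkM hc hs.
pose D := [set \pi_(gr I) q | q in [set q : rees I | forall j, (j < M)%N -> (val q)`_j = 0]].
have hD : is_ideal D.
  split=> [|_ _ [p hp <-] [q hq <-]|r _ [p hp <-]].
  - by exists 0; [move=> j _; rewrite raddf0 coef0|rewrite raddf0].
  - exists (p + q); last by rewrite raddfD.
    by move=> j hj; rewrite raddfD coefD hp // hq // addr0.
  - exists (repr r * p); last by rewrite pi_gr_mul reprK.
    move=> j hj; rewrite rmorphM coefM big1 // => i _.
    by rewrite hp ?mulr0 // (leq_ltn_trans (leq_subr _ _)).
have hsD : [set` s] `<=` D.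
  move=> _ /hs[a ha ->]; exists (rees_monom I M a) => // j hj.
  by rewrite /= val_rees_monom // coefZ coefXn ltn_eqF // mulr0.
move=> /(ideal_gen_sub hD hsD)[q hq /pi_grP/(_ k)].
rewrite hq // val_rees_monom // coefZ coefXn eqxx mulr1 sub0r => /ideal_expN.
by rewrite opprK.
Qed.

End AssociatedGraded.

(** * Maximality of the Ratliff-Rush closure *)

Section Main.
Variables (A : comNzRingType) (m : set A) (d : nat).
Hypotheses (hCM : CM_local_ring m d) (hd : (2 <= d)%N) (hres : infinite_set (cosets m)).
Variable I : set A.
Hypotheses (hIm : primary_to m I) (hG : gr_generalized_CM I d).

Let hI : is_ideal I := primary_to_ideal hIm.
Let hN : noetherian A. Proof. by case: hCM. Qed.
Let hm : local_ring m. Proof. by case: hCM. Qed.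
Let hIpow : exists N, ideal_exp m N `<=` I.
Proof. by apply: primary_to_exp (noetherian_acc hN) _ hIm; case: hm => [[]]. Qed.

(* The annihilator in G(I) of the class of b in degree s *)
Definition ann_family (b : A) s k : set A :=
  [set c | ideal_exp I k c /\ ideal_exp I (k + s).+1 (c * b)].

Lemma ann_familyP b s : rees_family I (ann_family b s).
Proof.
split=> [k|k c []//|k x c hx [hc hcb]].
  split=> [|c c' [hc hcb] [hc' hcb']|r c [hc hcb]].
  - by split; [|rewrite mul0r]; apply: ideal_exp0.
  - by split; [|rewrite mulrDl]; apply: ideal_expD.
  - by split; [|rewrite -[r *: c]/(r * c) -mulrA]; apply: ideal_expZ.
by split; [|rewrite -mulrA addSn]; apply: ideal_expSM.
Qed.

Lemma finite_ann_family b s : ideal_exp I s b -> finite_family I (ann_family b s).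
Proof.
move=> hb; apply: finite_familyS (finite_adic_family hCM hIpow) (ann_familyP b s) _.
move=> k c hc; split; first by apply: ideal_exp_anti hc.
by rewrite -addSn; apply: ideal_exp_mul.
Qed.

(** In terms of [G]: if [G y] has dimension less than [d], where [y] is the class of [b], then [y]
    is annihilated by all elements of some degree [N]. *)
Lemma small_annihilated b s : ideal_exp I s b ->
  evpoly d.-1 (hilb I (ann_family b s)) ->
  exists N, forall u, ideal_exp I N u -> ideal_exp I (N + s).+1 (u * b).
Proof.
move=> hb hdim; have hfam := ann_familyP b s.
have [w [hw hwI]] := generic_elements hN hm hI hres.
have [ws [hws hwsI [k0 hk0]]] := parameters hI hN hw hwI hfam (finite_ann_family hb) hdim.
have [hann _ _] := hfam.
have [cs hcs] := hN (hann k0.+1); have [xs hxs] := hN hI.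
have hcsI c : c \in cs -> ann_family b s k0.+1 c.
  by move=> hc; rewrite hcs; apply: sub_ideal_gen.
pose zs := [seq gr_monom I k0.+1 c | c <- cs].
pose y := gr_monom I s b.
have hzy z : z \in zs -> z * y = 0.
  move=> /mapP[c /hcsI[hc hcb] ->]; rewrite gr_monomM // gr_monom_eq0 //.
have hR : acc (gr I) := acc_gr (noetherian_rees hI hN).
have hP := is_ideal_gr_plus I.
pose vs := [seq gr_monom I 1 v | v <- ws].
have hrad M h : gr_plus I h ->
    exists N, ideal_gen [set` [seq v ^+ M | v <- vs] ++ zs] (h ^+ N).
  move=> hh; set D := ideal_gen [set` _ ++ _].
  have hD : is_ideal D by apply: is_ideal_gen.
  have hDM x z : D z -> D (x * z) by apply: (idealMl _ hD).
  have [//|k x z _|x|N1 hN1] := @graded_nilpotent _ (vs ++ zs) (fun=> D).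
  - exact: hDM.
  - rewrite mem_cat => /orP[hx|hx]; [exists M|exists 1%N]; apply: sub_ideal_gen => /=.
      by rewrite mem_cat (map_f (fun v => v ^+ M)).
    by rewrite mem_cat hx orbT.
  set D' := ideal_gen [set` vs ++ zs] in hN1.
  have hD' : is_ideal D' by apply: is_ideal_gen.
  (* By the choice of [ws], degree [k0 + 1] of [G] lies in the ideal of [vs] and [zs], so degree-one
     elements are nilpotent modulo it. Passing to the [M]-th powers of [vs] preserves this
     nilpotence. *)
  have hpow : ideal_exp I k0.+1 `<=`
      [set c | ideal_exp I k0.+1 c /\ D' (gr_monom I k0.+1 c)].
    apply: hk0; first exact: gr_monom_ideal.
      rewrite hcs; apply: ideal_gen_sub; first exact: gr_monom_ideal.
      move=> c hc; split; first by have [] := hcsI c hc.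
      by apply: sub_ideal_gen; rewrite /= mem_cat map_f ?orbT.
    move=> x v hx hv; have hvI : ideal_exp I 1 v by rewrite ideal_exp1 //; apply: hwsI.
    split; first by rewrite mulrC; apply: ideal_expSM => //; apply: hwsI.
    rewrite -[k0.+1]addn1 -gr_monomM //; apply: (idealMl _ hD').
    by apply: sub_ideal_gen; rewrite /= mem_cat map_f.
  have [//|k x z _|_ /mapP[x hx ->]|N2 hN2] :=
    @graded_nilpotent _ [seq gr_monom I 1 x | x <- xs] (fun=> D).
  - exact: hDM.
  - have hxI : I x by rewrite hxs; apply: sub_ideal_gen.
    exists (k0.+1 * N1)%N; rewrite exprM gr_monomX //; apply: hN1; apply: ideal_expX.
    by have [] := hpow _ (ideal_expX k0.+1 hxI).
  - by exists N2; apply: hN2; apply: ideal_expX; apply: gr_plus_gen.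
have hpow c : I c -> exists p, ideal_exp I (p + s).+1 (c ^+ p * b).
  move=> hc; have [E hE] := hG.
  have [p hp] := koszul_annihilator hR hP (ltnW hd) (gr_plus_monom hI hc) hE hzy.
  (* [M] may depend on [p], which came first. It exceeds the degree [p + s] of the class of
     [c ^+ p * b], which therefore vanishes. *)
  exists p; pose M := (p + s).+1.
  apply: (@gr_monom_low_degree _ I [seq v ^+ M | v <- vs] M) => //.
  - by apply: ideal_exp_mul => //; apply: ideal_expX.
  - move=> _ /mapP[_ /mapP[v hv ->] ->]; exists (v ^+ M).
      by apply: ideal_expX; apply: hwsI.
    by rewrite gr_monomX //; apply: hwsI.
  rewrite -gr_monomM //; last exact: ideal_expX.
  rewrite -gr_monomX //; apply: hp; last exact: hrad.
  by rewrite !size_map.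
(* Here the sets vary with the degree: a factor from [I] raises both the degree and the order
   demanded of [u * b] by one. *)
have [k|k x u hx hu|x hx|N hNN] :=
    @graded_nilpotent _ xs (fun k => [set u | ideal_exp I (k + s).+1 (u * b)]).
- split=> [|c c' hc hc'|r c hc] /=.
  + by rewrite mul0r; apply: ideal_exp0.
  + by rewrite mulrDl; apply: ideal_expD.
  + by rewrite -[r *: c]/(r * c) -mulrA; apply: ideal_expZ.
- rewrite /= -mulrA addSn; apply: ideal_expSM => //.
  by rewrite hxs; apply: sub_ideal_gen.
- by apply: hpow; rewrite hxs; apply: sub_ideal_gen.
- by exists N; rewrite {1}hxs.
Qed.

Section Maximality.
Variables (p : nat) (hp : (0 < p)%N) (J : set A).
Let K := ideal_exp I p.
Hypothesis hJ : coeff_family m d 1 K J.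

Lemma primary_to_power : primary_to m K.
Proof.
have [[hI1 hI2 _] _] := hIm.
apply: (primary_to_local (noetherian_acc hN) hm); first exact: is_ideal_exp.
  by move=> h; apply: hI2; apply: ideal_exp_sub h.
have [N hNI] := hIpow; exists (N * p)%N; exact: maximal_power_exp.
Qed.

(** For [j + k0 = p * k], [I^j b] lies in [x I^(p k)], hence in [J^(k+1)]. So the Hilbert function
    at [j] is at most the length of [J^(k+1)/K^(k+1)], which grows with degree at most [d - 2]. *)
Lemma ann_family_dim x k0 i a : J x -> ideal_exp I k0 a -> (i < p)%N ->
  ideal_exp I (k0 + i) (x * a) ->
  evpoly d.-1 (hilb I (ann_family (x * a) (k0 + i))).
Proof.
move=> hx ha hip hb; set b := x * a; set s := (k0 + i)%N.
have hKm := primary_to_power.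
have hKpow : exists N, ideal_exp m N `<=` K.
  by apply: primary_to_exp (noetherian_acc hN) _ hKm; case: hm => [[]].
have [hJm hKJ [e [e' [he he' hee]]]] := hJ.
have [C [N0 hC]] := hilbert_coeffs_bound hCM hd hKm hKJ he he' hee.
have [s' hs'] := hilb_evpoly hI hN (ann_familyP b s) (finite_ann_family hb).
have -> : d.-1 = (d - 2).+1 by lia.
(* The factor comes from [leq_binb_scale] with [q = k0.+1], since [k <= k0.+1 * j.+1] for the [k]
   and [j] below. *)
apply: (evpoly_degree (C := (C * k0.+2 ^ (d - 2))%N) hs') => M.
pose k := (N0 + k0 + M)%N; pose j := (p * k - k0)%N.
have hk0 : (k0 + M <= p * k)%N by rewrite /k; nia.
exists j; split; first by rewrite /j; lia.
have hjk : (j + k0 = p * k)%N by rewrite /j; lia.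
apply: (@leq_trans (C * binb (d - 2) k)); last first.
  rewrite -mulnA leq_mul2l; apply/orP; right.
  apply: leq_trans (leq_binb_scale _ _ _); apply: leq_binbr; nia.
apply: (leq_trans _ (hC k _)); last by rewrite /k; lia.
have hKk : ideal_exp K k.+1 = ideal_exp I (p * k.+1) by rewrite ideal_exp_exp.
have hKi : is_ideal (ideal_exp K k.+1) by apply: is_ideal_exp.
have hIj : is_ideal (ideal_exp I j) by apply: is_ideal_exp.
pose N1 := [set c | ideal_exp I j c /\ ideal_exp K k.+1 (c * b)].
(* Here [i < p] enters: [j + s + 1 = p * k + i + 1] is at most [p * k.+1]. *)
have hN1 : N1 `<=` ann_family b s j.
  move=> c [hc hcb]; split=> //; move: hcb; rewrite hKk; apply: ideal_exp_anti.
  by rewrite /s mulnS; lia.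
have hQ : [set z | exists c u, [/\ ideal_exp I j c, ideal_exp K k.+1 u & z = c * b + u]]
    `<=` ideal_exp J k.+1.
  move=> _ [c [u [hc hu ->]]]; apply: ideal_expD; last exact: (ideal_expS_mono hKJ).
  rewrite /b mulrCA; apply: ideal_expSM => //; apply: (ideal_expS_mono hKJ).
  by rewrite ideal_exp_exp -hjk; apply: ideal_exp_mul.
have hfin : @finite_length A A^o (ideal_exp K k.+1) (ideal_exp J k.+1).
  apply: finite_length_sub (finite_length_exp hCM k.+1 hKpow) => //.
  exact: ideal_expS_mono.
have hsubQ : ideal_exp K k.+1 `<=`
    [set z | exists c u, [/\ ideal_exp I j c, ideal_exp K k.+1 u & z = c * b + u]].
  by move=> u hu; exists 0, u; rewrite mul0r add0r; split=> //; apply: ideal0.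
have hN1i : is_ideal N1.
  split=> [|c c' [hc hcb] [hc' hcb']|r c [hc hcb]].
  - by split; [|rewrite mul0r]; apply: ideal_exp0.
  - by split; [|rewrite mulrDl]; apply: ideal_expD.
  - by split; [|rewrite -[r *: c]/(r * c) -mulrA]; apply: ideal_expZ.
have hfN1 : @finite_length A A^o N1 (ideal_exp I j).
  apply: finite_length_sub (finite_length_exp hCM (p * k.+1) hIpow) => //; first by move=> c [].
  move=> c hc; split; first by apply: ideal_exp_anti hc; rewrite /j mulnS; lia.
  by rewrite hKk mulrC; apply: ideal_expZ.
have [hann hannI _] := ann_familyP b s.
apply: (@leq_trans (@len A A^o N1 (ideal_exp I j))).
  by apply: len_sub => //; apply: hann.
by rewrite len_mulr //; apply: len_sub.
Qed.

Lemma coeff_family_ratliff_rush : J `<=` ratliff_rush K.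
Proof.
move=> x hx.
suff [k0 hk0] : exists k0, forall k, (k0 <= k)%N -> forall c, ideal_exp I k c ->
    ideal_exp I (k + p) (x * c).
  (* The successor is taken because the union defining the closure starts at 1. *)
  exists k0.+1 => // c; rewrite /K !ideal_exp_exp => hc.
  by have := hk0 (p * k0.+1)%N _ c hc; rewrite [(p * k0.+2)%N]mulnS addnC; apply; nia.
suff : forall i, (i <= p)%N -> exists k0, forall k, (k0 <= k)%N ->
    forall c, ideal_exp I k c -> ideal_exp I (k + i) (x * c).
  by apply.
elim=> [_|i IH hip].
  by exists 0%N => k _ c; rewrite addn0; apply: ideal_expZ.
have [k0 hk0] := IH (ltnW hip); set s := (k0 + i)%N.
have [cs hcs] := hN (is_ideal_exp I k0).
have /choice[f hf] : forall a, exists N, a \in cs ->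
    forall u, ideal_exp I N u -> ideal_exp I (N + s).+1 (u * (x * a)).
  move=> a; have [ha|_] := boolP (a \in cs); last by exists 0%N.
  have hak : ideal_exp I k0 a by rewrite hcs; apply: sub_ideal_gen.
  have hb := hk0 k0 (leqnn _) a hak.
  have [N h] := small_annihilated hb (ann_family_dim hx hak hip hb).
  by exists N.
(* One degree serves the finitely many generators of [I^k0]; [hall] extends the estimate to [I^k0]
   by linearity. *)
pose N := \max_(a <- cs) f a.
have hall n u a : (N <= n)%N -> ideal_exp I n u -> ideal_exp I k0 a ->
    ideal_exp I (n + s).+1 (u * (x * a)).
  move=> hn hu; have hi : is_ideal [set a | ideal_exp I (n + s).+1 (u * (x * a))].
    split=> [|v v' hv hv'|r v hv] /=.
    - by rewrite !mulr0; apply: ideal_exp0.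
    - by rewrite !mulrDr; apply: ideal_expD.
    - have -> : u * (x * (r * v)) = r * (u * (x * v)) by ring.
      exact: ideal_expZ.
  rewrite hcs; move: a; apply: ideal_gen_sub => // a ha /=.
  have hfn : (f a <= n)%N by apply: leq_trans hn; rewrite /N (big_rem a) //= leq_maxl.
  move: u hu {hi}; rewrite -(subnK hfn).
  apply: (@ideal_expD_sub _ _ _ _ [set u | ideal_exp I (n - f a + f a + s).+1 (u * (x * a))]).
    split=> [|v v' hv hv'|r v hv] /=.
    - by rewrite mul0r; apply: ideal_exp0.
    - by rewrite mulrDl; apply: ideal_expD.
    - by rewrite -[r *: v]/(r * v) -mulrA; apply: ideal_expZ.
  move=> v u hv hu /=; rewrite -mulrA -addnA -addnS; apply: ideal_exp_mul => //.
  exact: hf.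
exists (N + k0)%N => k hk.
have -> : k = (k - k0 + k0)%N by lia.
apply: (@ideal_expD_sub _ _ _ _ [set c | ideal_exp I (k - k0 + k0 + i.+1) (x * c)]).
  split=> [|v v' hv hv'|r v hv] /=.
  - by rewrite mulr0; apply: ideal_exp0.
  - by rewrite mulrDr; apply: ideal_expD.
  - by rewrite -[r *: v]/(r * v) mulrCA; apply: ideal_expZ.
move=> u a hu ha /=; rewrite mulrCA -addnA addnS addnS; apply: hall => //; lia.
Qed.

End Maximality.

End Main.

Theorem corollary1p2 (A : comNzRingType) (m : set A) (d : nat)
    (hA : CM_local_ring m d) (hd : (2 <= d)%N)
    (hres : infinite_set (cosets m))
    (I : set A) (hI : primary_to m I)
    (hG : gr_generalized_CM I d)
    (n : nat) (hn : (1 <= n)%N) :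
  coeff_ideal m d 1 (ideal_exp I n) = ratliff_rush (ideal_exp I n).
Proof.
have hK : primary_to m (ideal_exp I n) by apply: (primary_to_power hA hI).
have hL := ratliff_rush_coeff_family hA 1 (ltnW hd) hK.
have hmax J : coeff_family m d 1 (ideal_exp I n) J ->
    J `<=` ratliff_rush (ideal_exp I n).
  by apply: coeff_family_ratliff_rush.
(* The closure belongs to the family and contains all its members, so it is the only maximal element
   and the default value of [coeff_ideal] is not taken. *)
apply: xget_unique => [|L [[hLE hLmax] _]].
  split=> [|L [hLE hLmax]].
    by split=> // J hJ hLJ; apply/seteqP; split=> //; apply: hmax.
  by symmetry; apply: hLmax => //; apply: hmax.
by symmetry; apply: hLmax => //; apply: hmax.
Qed.
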